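(* Let $\{(R_n,B_n)\}_{n=1}^\infty$ be a sequence of admissible pairs in $\mathbb{R}^d$. Let $$\mu_n=\delta_{R_1^{-1}B_1}*\delta_{(R_2R_1)^{-1}B_2}*\cdots*\delta_{(R_n\cdots R_2R_1)^{-1}B_n},$$ and suppose that $\mu_n$ converges weakly to a Borel probability measure $\mu$ (the infinite convolution). Suppose moreover that $$\lim_{n\to\infty}\|R_1^{-1}R_2^{-1}\cdots R_n^{-1}\|=0.$$ For $n\ge1$ let $$\nu_{>n}=\delta_{R_{n+1}^{-1}B_{n+1}}*\delta_{(R_{n+2}R_{n+1})^{-1}B_{n+2}}*\cdots$$ (the weak limit of $\delta_{R_{n+1}^{-1}B_{n+1}}*\cdots*\delta_{(R_{n+k}\cdots R_{n+1})^{-1}B_{n+k}}$ as $k\to\infty$). If there is a subsequence $\{\nu_{>n_j}\}_{j\ge1}$ which is an equi-positive family, then $\mu$ is a spectral measure with a spectrum contained in $\mathbb{Z}^d$.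
   Context: A Borel probability measure $\mu$ on $\mathbb{R}^d$ is a spectral measure if there is a countable set $\Lambda\subseteq\mathbb{R}^d$ (a spectrum) such that $\{e^{2\pi i\lambda\cdot x}:\lambda\in\Lambda\}$ is an orthonormal basis of $L^2(\mu)$. For a finite set $A\subseteq\mathbb{R}^d$, $\delta_A=\frac{1}{\#A}\sum_{a\in A}\delta_a$. A pair $(R,B)$ with $R$ a $d\times d$ expanding integer matrix (all eigenvalues of modulus $>1$) and $B\subseteq\mathbb{Z}^d$ finite is an admissible pair if there is a finite $L\subseteq\mathbb{Z}^d$ with $\#L=\#B$ such that the matrix $\big[\frac{1}{\sqrt{\#B}}e^{-2\pi i(R^{-1}b)\cdot\ell}\big]_{b\in B,\ell\in L}$ is unitary. The Fourier transform is $\widehat{\mu}(\xi)=\int e^{-2\pi i\xi\cdot x}\,d\mu(x)$. A family $\Phi$ of Borel probability measures on $\mathbb{R}^d$ is equi-positive if there exist $\epsilon>0$ and $\gamma>0$ such that for every $x\in[0,1)^d$ and every $\mu\in\Phi$ there is $k_{x,\mu}\in\mathbb{Z}^d$ with $|\widehat{\mu}(x+y+k_{x,\mu})|\ge\epsilon$ for all $|y|<\gamma$, where $k_{x,\mu}=\mathbf{0}$ when $x=\mathbf{0}$. $\|\cdot\|$ is the operator norm. *)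

(* Defs.v *)
(* mathcomp-analysis (measures, integrals, topology) +
   mathcomp-real-closed (complex numbers R[i]). *)
From HB Require Import structures.
From mathcomp Require Import all_boot all_order all_algebra.
From mathcomp Require Import all_classical all_reals all_analysis.
From mathcomp Require Import complex.
From mathcomp Require Import algC.

Set Implicit Arguments.
Unset Strict Implicit.
Unset Printing Implicit Defensive.

Import Order.TTheory GRing.Theory Num.Theory.
Import numFieldNormedType.Exports.
Local Open Scope classical_set_scope.
Local Open Scope ring_scope.
Local Open Scope complex_scope.

(* R^d is represented by column vectors 'cV[R]_d; Z^d by 'cV[int]_d.       *)

(* R^d with its Borel sigma-algebra (generated by the open sets of the
   usual topology of 'cV[R]_d). *)
Definition Rd (R : realType) (d : nat) := g_sigma_algebraType (@open 'cV[R]_d).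

(* integer vectors / matrices seen as real ones *)
Definition ivec (R : realType) d (v : 'cV[int]_d) : 'cV[R]_d :=
  map_mx (fun z : int => z%:~R) v.
Definition imx (R : realType) d (M : 'M[int]_d) : 'M[R]_d :=
  map_mx (fun z : int => z%:~R) M.

(* dot product and Euclidean norm on R^d *)
Definition dotv (R : realType) d (x y : 'cV[R]_d) : R := \sum_i x i 0 * y i 0.
Definition eucl (R : realType) d (x : 'cV[R]_d) : R := Num.sqrt (dotv x x).

(* operator norm (w.r.t. the Euclidean norm) of a real d x d matrix *)
Definition opnorm (R : realType) d (M : 'M[R]_d) : R :=
  sup [set eucl (M *m x) | x in [set x : 'cV[R]_d | eucl x <= 1]].

(* e^{2 pi i t} *)
Definition cexp2pi (R : realType) (t : R) : R[i] :=
  cos (2 * pi * t) +i* sin (2 * pi * t).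

(* |z|^2 and |z| for complex z, as reals *)
Definition csqn (R : realType) (z : R[i]) : R := (complex.Re z) ^+ 2 + (complex.Im z) ^+ 2.
Definition cmod (R : realType) (z : R[i]) : R := Num.sqrt (csqn z).

(* expanding integer matrix: every complex (necessarily algebraic) eigenvalue has modulus > 1 *)
Definition expanding d (M : 'M[int]_d) : Prop :=
  forall a : algC,
    eigenvalue (map_mx (fun z : int => z%:~R) M : 'M[algC]_d) a -> 1 < `|a|.

(* unitary complex square matrix *)
Definition unitary (R : realType) n (H : 'M[R[i]]_n) : Prop :=
  H *m (map_mx Num.conj H)^T = 1%:M /\ (map_mx Num.conj H)^T *m H = 1%:M.

(* (M, B) admissible pair; finite sets B, L of Z^d are duplicate-free seqs *)
Definition admissible (R : realType) d (M : 'M[int]_d) (B : seq 'cV[int]_d) : Prop :=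
  expanding M /\ uniq B /\
  exists L : seq 'cV[int]_d, [/\ uniq L, size L = size B &
    unitary ((\matrix_(i, j)
       (((Num.sqrt (size B)%:R)^-1)%:C *
        cexp2pi (- dotv (invmx (imx R M) *m ivec R (nth 0 B i)) (ivec R (nth 0 L j)))))
       : 'M[R[i]]_(size B))].

(* integral of f against the discrete convolution delta_{A_1} * ... * delta_{A_k}
   (each delta_A = uniform probability on the finite set A), evaluated at
   shift x :  conv_int [:: A_1; ...; A_k] f 0 = \int f d(delta_{A_1}*...*delta_{A_k}) *)
Fixpoint conv_int (R : realType) d (As : seq (seq 'cV[R]_d)) (f : 'cV[R]_d -> R)
    (x : 'cV[R]_d) : R :=
  match As with
  | [::] => f x
  | A :: As' => (size A)%:R^-1 * \sum_(a <- A) conv_int As' f (x + a)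
  end.

(* Given the sequence (R_n, B_n)_{n>=1}:
   tailprod m k = R_{m+k} ... R_{m+1}   (tailprod m 0 = identity) *)
Fixpoint tailprod (R : realType) d (Rs : nat -> 'M[int]_d) (m k : nat) : 'M[R]_d :=
  match k with
  | 0 => 1%:M
  | k'.+1 => imx R (Rs (m + k'.+1)%N) *m tailprod R Rs m k'
  end.

(* the set (R_{m+k} ... R_{m+1})^{-1} B_{m+k} *)
Definition tail_atoms (R : realType) d (Rs : nat -> 'M[int]_d)
    (Bs : nat -> seq 'cV[int]_d) (m k : nat) : seq 'cV[R]_d :=
  [seq invmx (tailprod R Rs m k) *m ivec R b | b <- Bs (m + k)%N].

(* integral of f against
   delta_{R_{m+1}^{-1}B_{m+1}} * ... * delta_{(R_{m+K}...R_{m+1})^{-1}B_{m+K}} *)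
Definition tail_conv_int (R : realType) d (Rs : nat -> 'M[int]_d)
    (Bs : nat -> seq 'cV[int]_d) (m K : nat) (f : 'cV[R]_d -> R) : R :=
  conv_int [seq tail_atoms R Rs Bs m k | k <- iota 1 K] f 0.

(* bounded continuous real functions on R^d *)
Definition bounded_continuous (R : realType) d (f : 'cV[R]_d -> R) : Prop :=
  continuous f /\ exists M : R, forall x, `|f x| <= M.

(* weak convergence of the finite convolutions (m fixed, K -> oo) to mu *)
Definition tail_conv_weakly_to (R : realType) d (Rs : nat -> 'M[int]_d)
    (Bs : nat -> seq 'cV[int]_d) (m : nat) (mu : probability (Rd R d) R) : Prop :=
  forall f : 'cV[R]_d -> R, bounded_continuous f ->
    (fun K => tail_conv_int Rs Bs m K f) @ \oo --> Rintegral mu setT f.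

(* Fourier transform  hat mu (xi) = \int e^{-2 pi i xi.x} dmu(x) *)
Definition fourier (R : realType) d (mu : probability (Rd R d) R) (xi : 'cV[R]_d) : R[i] :=
  Rintegral mu setT (fun x : 'cV[R]_d => cos (2 * pi * dotv xi x))
  -i* Rintegral mu setT (fun x : 'cV[R]_d => sin (2 * pi * dotv xi x)).

(* equi-positive family indexed by I *)
Definition equi_positive (R : realType) d (I : Type) (nu : I -> probability (Rd R d) R) : Prop :=
  exists (eps gam : R), 0 < eps /\ 0 < gam /\
    forall (x : 'cV[R]_d), (forall i, 0 <= x i 0 < 1) ->
    forall j : I, exists k : 'cV[int]_d, (x = 0 -> k = 0) /\
      forall y : 'cV[R]_d, eucl y < gam -> eps <= cmod (fourier (nu j) (x + y + ivec R k)).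

(* L^2(mu) of complex-valued functions *)
Definition L2fun (R : realType) d (mu : probability (Rd R d) R) (f : 'cV[R]_d -> R[i]) : Prop :=
  measurable_fun (setT : set (Rd R d)) (fun x => complex.Re (f x)) /\
  measurable_fun (setT : set (Rd R d)) (fun x => complex.Im (f x)) /\
  (\int[mu]_x (csqn (f x))%:E < +oo)%E.

(* <f, g> = \int f conj(g) dmu *)
Definition L2inner (R : realType) d (mu : probability (Rd R d) R) (f g : 'cV[R]_d -> R[i]) : R[i] :=
  Rintegral mu setT (fun x : 'cV[R]_d => complex.Re (f x * (g x)^*))
  +i* Rintegral mu setT (fun x : 'cV[R]_d => complex.Im (f x * (g x)^*)).

Definition expo (R : realType) d (lam : 'cV[R]_d) : 'cV[R]_d -> R[i] :=
  fun x => cexp2pi (dotv lam x).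

(* Lam is a spectrum of mu: countable, {e_lam} orthonormal in L^2(mu) and its
   linear span is dense in L^2(mu) *)
Definition spectrum (R : realType) d (mu : probability (Rd R d) R) (Lam : set 'cV[R]_d) : Prop :=
  countable Lam /\
  (forall l1 l2, Lam l1 -> Lam l2 -> L2inner mu (expo l1) (expo l2) = (l1 == l2)%:R) /\
  (forall f, L2fun mu f -> forall eps : R, 0 < eps ->
     exists (s : seq 'cV[R]_d) (c : 'cV[R]_d -> R[i]),
       {subset s <= Lam} /\
       (\int[mu]_x (csqn (f x - \sum_(l <- s) c l * expo l x))%:E < eps%:E)%E).

Definition spectral_measure (R : realType) d (mu : probability (Rd R d) R) : Prop :=
  exists Lam, spectrum mu Lam.

(* Main.v *)
Require Import Defs.
From HB Require Import structures.
From mathcomp Require Import all_boot all_order all_algebra.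
From mathcomp Require Import all_classical all_reals all_analysis.
From mathcomp Require Import complex.
From mathcomp Require Import measurable_realfun algC ring lra.
Import Order.TTheory GRing.Theory Num.Theory.
Import numFieldNormedType.Exports.
Local Open Scope classical_set_scope.
Local Open Scope ring_scope.

(** Write [F_n] for the Fourier transform of the [n]-th partial convolution and
    [P_n = R_n ... R_1], so that [mu^ (xi) = F_n (xi) * nu_n^ (P_n^-T xi)].  A finite
    [S] in [Z^d] with [\sum_(l in S) |F_n (xi + l)|^2 = 1] for all [xi] is a spectrum
    of the [n]-th convolution; such sets compose along the product, and since [F_n]
    is periodic under [P_n^T Z^d] their elements may be moved by [P_n^T Z^d].
    Equi-positivity is used to move them where [|nu_n^|] is at least [eps], while
    [|P_n^-1| -> 0] allows the earlier spectra to be kept unchanged.  On the increasing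
    union [Lam] orthogonality is inherited, and [|F_n|^2 <= eps^-2 |mu^|^2] on the
    [n]-th stage, so dominated convergence gives [\sum_Lam |mu^ (xi + l)|^2 = 1],
    i.e. every exponential lies in the closed span of [Lam].  Exponentials are total
    in [L^2(mu)]: the bounded functions approximable by trigonometric polynomials form
    an algebra closed under bounded pointwise limits, so the sets whose indicator is
    approximable form a sigma-algebra, and it contains the half-spaces. *)

Set Implicit Arguments.
Unset Strict Implicit.

(** * Complex exponentials and the squared modulus *)

Section ComplexExponential.
Local Open Scope complex_scope.
Variable R : realType.
Implicit Types (t u : R) (z w : R[i]).

Lemma csqn_ge0 z : 0 <= csqn z.
Proof. by rewrite addr_ge0 ?sqr_ge0. Qed.

Lemma csqnM z w : csqn (z * w) = csqn z * csqn w.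
Proof. by case: z w => [a b] [c e]; rewrite /csqn /=; ring. Qed.

Lemma csqn0 : csqn (0 : R[i]) = 0.
Proof. by rewrite /csqn /= expr0n addr0. Qed.

Lemma csqn1 : csqn (1 : R[i]) = 1.
Proof. by rewrite /csqn /= expr0n expr1n addr0. Qed.

Lemma csqn_eq0 z : csqn z = 0 -> z = 0.
Proof.
case: z => a b; rewrite /csqn /= => /eqP.
by rewrite paddr_eq0 ?sqr_ge0 // !sqrf_eq0 => /andP[/eqP -> /eqP ->].
Qed.

Lemma csqn_real t : csqn t%:C = t ^+ 2.
Proof. by rewrite /csqn /= expr0n addr0. Qed.

Lemma csqnE z : (csqn z)%:C = z * z^*.
Proof.
case: z => a b; apply/eqP; rewrite eq_complex /csqn /=.
by apply/andP; split; apply/eqP; ring.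
Qed.

Lemma csqnD_le z w : csqn (z + w) <= 2 * csqn z + 2 * csqn w.
Proof.
case: z w => [a b] [c e]; rewrite /csqn /=.
have := sqr_ge0 (a - c); have := sqr_ge0 (b - e); nra.
Qed.

Lemma cmod_ge z (e : R) : 0 <= e -> (e <= cmod z) = (e ^+ 2 <= csqn z).
Proof.
move=> e0; rewrite -{1}(ger0_norm e0) -sqrtr_sqr /cmod.
by rewrite ler_sqrt // csqn_ge0.
Qed.

Lemma cexp2piD t u : cexp2pi (t + u) = cexp2pi t * cexp2pi u.
Proof. by rewrite /cexp2pi mulrDr cosD sinD; apply/eqP; rewrite eq_complex /= eqxx addrC eqxx. Qed.

Lemma cexp2pi0 : cexp2pi (0 : R) = 1.
Proof. by rewrite /cexp2pi mulr0 cos0 sin0. Qed.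

Lemma cexp2piN t : cexp2pi (- t) = (cexp2pi t)^*.
Proof. by rewrite /cexp2pi mulrN cosN sinN. Qed.

Lemma cexp2pi_conj t : Num.conj (cexp2pi t) = cexp2pi (- t).
Proof. by rewrite cexp2piN. Qed.

Lemma csqn_cexp2pi t : csqn (cexp2pi t) = 1.
Proof. by rewrite /csqn /= cos2Dsin2. Qed.

Lemma cexp2pi_nat (n : nat) : cexp2pi (n%:R : R) = 1.
Proof.
elim: n => [|n IHn]; first exact: cexp2pi0.
rewrite -natr1 cexp2piD IHn mul1r /cexp2pi mulr1 mulrC mulr_natr.
have -> : (pi *+ 2 : R) = pi + pi by rewrite mulr2n.
rewrite cosD sinD.
rewrite cospi sinpi !mulr0 mulrN1 opprK subr0 mul0r addr0 //.
Qed.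

Lemma cexp2pi_int (z : int) : cexp2pi (z%:~R : R) = 1.
Proof.
by case: z => n; [exact: cexp2pi_nat|rewrite NegzE mulrNz cexp2piN cexp2pi_nat conjc1].
Qed.

End ComplexExponential.

(** * The dot product, integer vectors and integer matrices *)

Section Vectors.
Local Open Scope complex_scope.
Variables (R : realType) (d : nat).
Implicit Types (x y : 'cV[R]_d) (M : 'M[R]_d).

Lemma dotvE x y : dotv x y = (x^T *m y) 0 0.
Proof. by rewrite mxE; apply: eq_bigr => i _; rewrite mxE. Qed.

Lemma dotvC x y : dotv x y = dotv y x.
Proof. by apply: eq_bigr => i _; rewrite mulrC. Qed.

Lemma dotvDl x y z : dotv (x + y) z = dotv x z + dotv y z.
Proof. by rewrite !dotvE linearD mulmxDl mxE. Qed.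

Lemma dotvDr x y z : dotv x (y + z) = dotv x y + dotv x z.
Proof. by rewrite !dotvE mulmxDr mxE. Qed.

Lemma dotvNl x y : dotv (- x) y = - dotv x y.
Proof. by rewrite !dotvE linearN mulNmx mxE. Qed.

Lemma dotv0l y : dotv 0 y = 0.
Proof. by rewrite dotvE linear0 mul0mx mxE. Qed.

Lemma dotv0r y : dotv y 0 = 0.
Proof. by rewrite dotvC dotv0l. Qed.

Lemma dotv_trmx M x y : dotv (M^T *m x) y = dotv x (M *m y).
Proof. by rewrite !dotvE trmx_mul trmxK mulmxA. Qed.

Lemma ivecD (u v : 'cV[int]_d) : ivec R (u + v) = ivec R u + ivec R v.
Proof. exact: map_mxD. Qed.

Lemma ivecB (u v : 'cV[int]_d) : ivec R (u - v) = ivec R u - ivec R v.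
Proof. exact: map_mxB. Qed.

Lemma ivec0 : ivec R (0 : 'cV[int]_d) = 0.
Proof. exact: map_mx0. Qed.

Lemma ivec_inj : injective (@ivec R d).
Proof. by move=> u v /matrixP uv; apply/matrixP => i j; have := uv i j; rewrite !mxE => /intr_inj. Qed.

Lemma ivec_mul (A : 'M[int]_d) (u : 'cV[int]_d) : ivec R (A *m u) = imx R A *m ivec R u.
Proof. exact: map_mxM. Qed.

Lemma imx_mul (A B : 'M[int]_d) : imx R (A *m B) = imx R A *m imx R B.
Proof. exact: map_mxM. Qed.

Lemma imx_tr (A : 'M[int]_d) : imx R A^T = (imx R A)^T.
Proof. by rewrite /imx map_trmx. Qed.

Lemma imx1 : imx R (1%:M : 'M[int]_d) = 1%:M.
Proof. exact: map_mx1. Qed.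

Lemma dotv_ivec (u v : 'cV[int]_d) : exists z : int, dotv (ivec R u) (ivec R v) = z%:~R.
Proof.
exists (\sum_i u i 0 * v i 0); rewrite rmorph_sum; apply: eq_bigr => i _.
by rewrite !mxE rmorphM.
Qed.

(** A vanishing determinant would make 0 an eigenvalue, and its modulus does not exceed 1. *)
Lemma expanding_unitmx (A : 'M[int]_d) : expanding A -> imx R A \in unitmx.
Proof.
move=> exA; rewrite unitmxE det_map_mx unitfE intr_eq0.
apply/negP => /eqP detA0.
suff : (1 < `|0 : algC|)%R by rewrite normr0 ltr10.
apply: exA; set B := map_mx _ _.
have detB : \det B = 0 by rewrite det_map_mx detA0.
rewrite /eigenvalue /eigenspace raddf0 subr0 kermx_eq0.
by rewrite row_free_unit unitmxE detB unitr0.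
Qed.

End Vectors.

(** * Fourier transforms and spectra of finite uniform measures *)

Section FiniteSpectra.
Local Open Scope complex_scope.
Variables (R : realType) (d : nat).
Implicit Types (x xi : 'cV[R]_d) (A : seq 'cV[R]_d) (F G : 'cV[R]_d -> R[i]).
Implicit Types (S T : seq 'cV[int]_d) (P : 'M[int]_d).

(** The Fourier transform of [delta_A]; it vanishes identically when [A] is empty, as the inverse of
    0 is 0. *)
Definition dft A xi : R[i] :=
  ((size A)%:R^-1)%:C * \sum_(a <- A) cexp2pi (- dotv xi a).

Lemma Re_rmul (r : R) (z : R[i]) : complex.Re (r%:C * z) = r * complex.Re z.
Proof. by case: z => a b /=; rewrite mul0r subr0. Qed.

Lemma Im_rmul (r : R) (z : R[i]) : complex.Im (r%:C * z) = r * complex.Im z.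
Proof. by case: z => a b /=; rewrite mul0r addr0. Qed.

(** The Fourier transform turns convolution into a product. The two parts are treated separately
    because [conv_int] integrates real functions; the base point [x] contributes a phase and must be
    general for the induction. *)
Lemma conv_int_fourier (As : seq (seq 'cV[R]_d)) xi x :
  conv_int As (fun y => cos (2 * pi * dotv xi y)) x =
    complex.Re ((\prod_(A <- As) dft A xi) * cexp2pi (- dotv xi x)) /\
  conv_int As (fun y => sin (2 * pi * dotv xi y)) x =
    - complex.Im ((\prod_(A <- As) dft A xi) * cexp2pi (- dotv xi x)).
Proof.
elim: As x => [|A As IHAs] x /=.
  by rewrite big_nil mul1r /cexp2pi /= mulrN cosN sinN opprK.
have -> : \prod_(j <- A :: As) dft j xi * cexp2pi (- dotv xi x) =
  ((size A)%:R^-1)%:C *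
    \sum_(a <- A) (\prod_(B <- As) dft B xi * cexp2pi (- dotv xi (x + a))).
  rewrite big_cons /dft -!mulrA; congr (_ * _).
  rewrite mulr_suml; apply: eq_bigr => a _.
  by rewrite dotvDr opprD cexp2piD; ring.
rewrite Re_rmul Im_rmul !raddf_sum /= -mulrN -sumrN.
by split; congr (_ * _); apply: eq_bigr => a _; have [] := IHAs (x + a).
Qed.

(** Cauchy-Schwarz against the constant 1, for real and imaginary parts separately. *)
Lemma csqn_sum_le (I : Type) (r : seq I) (z : I -> R[i]) :
  csqn (\sum_(i <- r) z i) <= (size r)%:R * \sum_(i <- r) csqn (z i).
Proof.
have CS (c : I -> R) : (\sum_(i <- r) c i) ^+ 2 <= (size r)%:R * \sum_(i <- r) c i ^+ 2.
  elim: r => [|i r IHr]; first by rewrite !big_nil expr0n mulr0.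
  rewrite !big_cons /= -natr1.
  set s := \sum_(_ <- _) _ in IHr *; set q := \sum_(_ <- _) _ in IHr *.
  have q0 : 0 <= q by apply: sumr_ge0 => j _; exact: sqr_ge0.
  case: (size r) IHr => [|n] IHr.
    have s0 : s = 0 by apply/eqP; rewrite -sqrf_eq0 eq_le sqr_ge0 andbT (le_trans IHr)// mul0r.
    by rewrite s0; nra.
  set N := n.+1%:R in IHr *.
  have N0 : 0 < N by rewrite ltr0n.
  (* After multiplication by [N], the induction hypothesis [s^2 <= N q] reduces this to
     [(N c_i - s)^2 >= 0]. *)
  have key : 2 * (c i * s) <= N * c i ^+ 2 + q.
    rewrite -(ler_pM2l N0) mulrDr (le_trans _ (lerD (lexx _) IHr)) //.
    by have := sqr_ge0 (N * c i - s); nra.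
  by nra.
rewrite /csqn !raddf_sum /= big_split mulrDr lerD //.
Qed.

Lemma csqn_dft_le1 A xi : csqn (dft A xi) <= 1.
Proof.
have [A0|A0] := eqVneq (size A) 0%N.
  by rewrite /dft A0 invr0 mul0r csqn0 ler01.
rewrite /dft csqnM csqn_real.
rewrite (le_trans (ler_wpM2l (sqr_ge0 _) (csqn_sum_le _ _)))//.
under eq_bigr do rewrite csqn_cexp2pi.
by rewrite big_const_seq count_predT iter_addr_0 expr2 mulrACA mulVf ?pnatr_eq0// mulr1.
Qed.

(** Parseval's identity for every exponential: when [F] is the transform of a finite uniform
    measure, this says that [S] is a spectrum of it. *)
Definition spec F S := forall xi, \sum_(l <- S) csqn (F (xi + ivec R l)) = 1.

Definition zperiodic F P :=
  forall xi (k : 'cV[int]_d), F (xi + ivec R (P^T *m k)) = F xi.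

Lemma spec_neq_nil F S : spec F S -> S <> [::].
Proof. by move=> SF S0; have := SF 0; rewrite S0 big_nil => /esym/eqP; rewrite oner_eq0. Qed.

Lemma spec_shift F S l : spec F S -> spec F [seq v - l | v <- S].
Proof.
move=> SF xi; rewrite big_map -[RHS](SF (xi - ivec R l)); apply: eq_bigr => v _.
by rewrite ivecB addrA addrAC.
Qed.

Lemma spec0 F S : spec F S -> exists T, spec F T /\ 0 \in T.
Proof.
case: S => [/spec_neq_nil//|l S] /(spec_shift l) SF.
by exists [seq v - l | v <- l :: S]; split=> //=; rewrite subrr inE eqxx.
Qed.

(** At [xi = - l] every occurrence of [l] contributes [|F 0|^2 = 1], and the total is 1. *)
Lemma spec_uniq F S : spec F S -> F 0 = 1 -> uniq S.
Proof.
move=> SF F0; apply: count_mem_uniq => l.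
have [lS|/count_memPn//] := boolP (l \in S).
apply/eqP; rewrite eqn_leq -has_count has_pred1 lS andbT.
rewrite -(ler_nat R) -[leRHS](SF (- ivec R l)) (bigID (pred1 l)) /=.
have -> : \sum_(i <- S | i == l) csqn (F (- ivec R l + ivec R i)) = (count_mem l S)%:R.
  under eq_bigr => i /eqP -> do rewrite addrC subrr F0 csqn1.
  by rewrite big_const_seq iter_addr_0.
by rewrite lerDl sumr_ge0// => *; exact: csqn_ge0.
Qed.

(** At [xi = - l1] the term of [l1] already exhausts the total 1, so all other terms vanish. *)
Lemma spec_orthogonal F S l1 l2 : spec F S -> F 0 = 1 -> l1 \in S -> l2 \in S ->
  l1 != l2 -> F (ivec R l2 - ivec R l1) = 0.
Proof.
move=> SF F0 l1S l2S l12; apply: csqn_eq0; apply/eqP.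
rewrite eq_le csqn_ge0 andbT -(lerD2l 1) addr0 -[leRHS](SF (- ivec R l1)).
have Su := spec_uniq SF F0.
rewrite (bigD1_seq l1)//= (addrC (- _)) subrr F0 csqn1 lerD2l.
rewrite -big_filter (bigD1_seq l2) ?filter_uniq ?mem_filter ?l2S 1?eq_sym ?l12//=.
by rewrite (addrC (- _)) lerDl sumr_ge0// => *; exact: csqn_ge0.
Qed.

Lemma spec_mod F P S (k : 'cV[int]_d -> 'cV[int]_d) : zperiodic F P -> spec F S ->
  spec F [seq l + P^T *m k l | l <- S].
Proof.
move=> FP SF xi; rewrite big_map -[RHS](SF xi); apply: eq_bigr => l _.
by rewrite ivecD addrA FP.
Qed.

(** By periodicity [F] does not see [P^T t], while [P^-T] sends [P^T t] to [t]. For fixed [l] the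
    sum over [T] is thus the identity for [G] at [P^-T (xi + l)], and the sum over [S] of what
    remains is the identity for [F]. *)
Lemma spec_comp F G H P S T : imx R P \in unitmx -> zperiodic F P ->
  (forall xi, H xi = F xi * G ((invmx (imx R P))^T *m xi)) ->
  spec F S -> spec G T ->
  spec H [seq l + P^T *m t | l <- S, t <- T].
Proof.
move=> Pu FP HE SF TG xi; rewrite big_allpairs_dep -[RHS](SF xi).
apply: eq_bigr => l _; rewrite -[RHS]mulr1.
rewrite -{1}(TG ((invmx (imx R P))^T *m (xi + ivec R l))) mulr_sumr.
apply: eq_bigr => t _; rewrite ivecD addrA HE csqnM FP; congr (_ * csqn (G _)).
by rewrite mulmxDr; congr (_ + _); rewrite ivec_mul imx_tr mulmxA -trmx_mul mulmxV// trmx1 mul1mx.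
Qed.

(** The pairing of [P^T k] with [P^-1 b] is the integer [k . b]. *)
Lemma dft_zperiodic P (B : seq 'cV[int]_d) : imx R P \in unitmx ->
  zperiodic (dft [seq invmx (imx R P) *m ivec R b | b <- B]) P.
Proof.
move=> Pu xi k; rewrite /dft !size_map !big_map; congr (_ * _).
apply: eq_bigr => b _; rewrite dotvDl opprD cexp2piD ivec_mul imx_tr dotv_trmx.
rewrite mulmxA mulmxV// mul1mx; have [z ->] := dotv_ivec R k b.
by rewrite -mulrNz cexp2pi_int mulr1.
Qed.

(** Up to the factor [N^(-1/2)], the row [u H] lists the values of the transform at [xi + l] for [l]
    in [L]. Since [H] times its adjoint is the identity, [u H] has the same norm as [u], whose [N]
    entries have modulus 1. *)
Lemma admissible_spec P (B : seq 'cV[int]_d) : admissible R P B -> B != [::] ->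
  exists S, spec (dft [seq invmx (imx R P) *m ivec R b | b <- B]) S.
Proof.
move=> [_ [_ [L [_ sLB [+ _]]]]] B0.
set H := (X in X *m _) => HH; exists L => xi.
set N := size B; have N0 : N%:R != 0 :> R by rewrite pnatr_eq0 size_eq0.
set A := [seq _ | _ <- _].
pose u : 'rV[R[i]]_N := \row_i cexp2pi (- dotv xi (invmx (imx R P) *m ivec R (nth 0 B i))).
have dftE (j : 'I_N) : dft A (xi + ivec R (nth 0 L j)) =
    ((Num.sqrt N%:R)^-1)%:C * (u *m H) 0 j.
  rewrite /dft size_map big_map (big_nth 0) big_mkord mxE mulr_sumr.
  rewrite [RHS]mulr_sumr; apply: eq_bigr => i _; rewrite !mxE.
  rewrite dotvDl opprD cexp2piD -/N.
  have -> : (N%:R^-1)%:C = ((Num.sqrt N%:R)^-1)%:C * ((Num.sqrt N%:R)^-1)%:C :> R[i].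
    by rewrite -rmorphM /= -invfM -expr2 sqr_sqrtr.
  by rewrite [dotv (ivec _ _) _]dotvC; ring.
rewrite (big_nth 0) sLB big_mkord.
under eq_bigr do rewrite dftE csqnM csqn_real.
rewrite -mulr_sumr exprVn sqr_sqrtr//.
suff -> : \sum_(i < N) csqn ((u *m H) 0 i) = N%:R by rewrite mulVf.
apply: (fmorph_inj (@real_complex R)) => /=; rewrite rmorph_sum /=.
under eq_bigr do rewrite csqnE.
transitivity (((u *m H) *m (map_mx Num.conj (u *m H))^T) 0 0).
  rewrite [RHS]mxE; apply: eq_bigr => j _; congr (_ * _).
  by rewrite [RHS]mxE [RHS]mxE.
rewrite map_mxM trmx_mul mulmxA -(mulmxA u) HH mulmx1 mxE.
transitivity (\sum_(j < N) (1 : R[i])).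
  apply: eq_bigr => j _; rewrite !mxE.
  exact: (etrans (esym (csqnE _)) (congr1 (@real_complex R) (csqn_cexp2pi _))).
by rewrite sumr_const card_ord rmorph_nat.
Qed.

End FiniteSpectra.

(** * Partial convolutions: splitting, periodicity and spectra *)

Section Products.
Local Open Scope complex_scope.
Variables (R : realType) (d : nat).
Variables (Rs : nat -> 'M[int]_d) (Bs : nat -> seq 'cV[int]_d).

(** The product is kept over the integers, because its transpose has to map [Z^d] to [Z^d] to
    provide periods. *)
Fixpoint tailprodZ (m k : nat) : 'M[int]_d :=
  if k is k'.+1 then Rs (m + k'.+1)%N *m tailprodZ m k' else 1%:M.

Lemma tailprodE m k : tailprod R Rs m k = imx R (tailprodZ m k).
Proof. by elim: k => [|k IHk] /=; rewrite ?imx1// imx_mul IHk. Qed.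

Lemma tailprod_cat m n k :
  tailprod R Rs m (n + k) = tailprod R Rs (m + n) k *m tailprod R Rs m n.
Proof. by elim: k => [|k IHk]; rewrite ?addn0 ?mul1mx// addnS /= IHk mulmxA -addnS addnA. Qed.

Lemma invmx_mul n (A B : 'M[R]_n) : A \in unitmx -> B \in unitmx ->
  invmx (A *m B) = invmx B *m invmx A.
Proof.
move=> Au Bu; have ABu : A *m B \in unitmx by rewrite unitmx_mul Au.
apply: (can_inj (mulKmx ABu)); rewrite mulmxV// mulmxA -(mulmxA A) mulmxV//.
by rewrite mulmx1 mulmxV.
Qed.

Lemma dft_map (A : 'M[R]_d) (Y : seq 'cV[R]_d) xi :
  dft [seq A *m y | y <- Y] xi = dft Y (A^T *m xi).
Proof.
rewrite /dft size_map big_map; congr (_ * _); apply: eq_bigr => y _.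
by rewrite dotv_trmx.
Qed.

(* Fourier transform of the convolution of the first [K] factors after [m]. *)
Definition fconv (m K : nat) (xi : 'cV[R]_d) : R[i] :=
  \prod_(k <- iota 1 K) dft (tail_atoms R Rs Bs m k) xi.

Lemma fconvS m K xi :
  fconv m K.+1 xi = fconv m K xi * dft (tail_atoms R Rs Bs m K.+1) xi.
Proof. by rewrite /fconv -(addn1 K) iotaD big_cat big_seq1 add1n addn1. Qed.

Lemma csqn_fconv_le1 m K xi : csqn (fconv m K xi) <= 1.
Proof.
elim: K => [|K IHK]; first by rewrite /fconv big_nil csqn1.
by rewrite fconvS csqnM mulr_ile1 ?csqn_ge0// csqn_dft_le1.
Qed.

Hypothesis Rs_unit : forall n, (0 < n)%N -> imx R (Rs n) \in unitmx.

Lemma tailprod_unit m k : tailprod R Rs m k \in unitmx.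
Proof.
elim: k => [|k IHk] /=; first exact: unitmx1.
by rewrite unitmx_mul IHk andbT Rs_unit// addnS.
Qed.

Lemma tail_atoms_cat m n k :
  tail_atoms R Rs Bs m (n + k) =
  [seq invmx (tailprod R Rs m n) *m y | y <- tail_atoms R Rs Bs (m + n) k].
Proof.
rewrite /tail_atoms -map_comp addnA; apply: eq_map => b /=.
by rewrite tailprod_cat invmx_mul ?tailprod_unit// mulmxA.
Qed.

(** The atoms after stage [m + n] are those of the tail rescaled by the inverse of the first [n]
    matrices; on the Fourier side this becomes the inverse transpose acting on [xi]. *)
Lemma fconv_cat m n k xi : fconv m (n + k) xi =
  fconv m n xi * fconv (m + n) k ((invmx (tailprod R Rs m n))^T *m xi).
Proof.
elim: k => [|k IHk]; first by rewrite addn0 [fconv (m + n) 0 _]/fconv big_nil mulr1.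
by rewrite addnS !fconvS IHk -mulrA -dft_map -tail_atoms_cat addnS.
Qed.

Hypothesis Bs_neq0 : forall n, (0 < n)%N -> Bs n != [::].

Lemma fconv0 m K : fconv m K 0 = 1.
Proof.
elim: K => [|K IHK]; first by rewrite /fconv big_nil.
rewrite fconvS IHK mul1r /dft size_map.
under eq_bigr do rewrite dotv0l oppr0 cexp2pi0.
rewrite big_const_seq count_predT iter_addr_0 size_map.
rewrite -[X in _ * X](rmorph_nat (@real_complex R)) -rmorphM mulVf //.
by rewrite pnatr_eq0 size_eq0 Bs_neq0// addnS.
Qed.

Lemma fconv1_atoms m :
  tail_atoms R Rs Bs m 1 = [seq invmx (imx R (Rs m.+1)) *m ivec R b | b <- Bs m.+1].
Proof. by rewrite /tail_atoms /= addn1 mulmx1. Qed.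

(** The period [(R P)^T k = P^T (R^T k)] is a period of the first [K] factors by induction; the last
    factor, evaluated after [P^-T], sees the shift [R^T k], which is a period of its own digit
    set. *)
Lemma fconv_periodic m K : zperiodic (fconv m K) (tailprodZ m K).
Proof.
elim: K => [|K IHK] xi k; first by rewrite /fconv !big_nil.
rewrite !fconvS /= trmx_mul -mulmxA IHK; congr (_ * _).
rewrite -(addn1 K) tail_atoms_cat !dft_map fconv1_atoms mulmxDr.
rewrite !ivec_mul imx_tr mulmxA -tailprodE -trmx_mul mulmxV ?tailprod_unit//.
by rewrite trmx1 mul1mx -ivec_mul addn1 addnS dft_zperiodic// Rs_unit.
Qed.

Hypothesis Bs_adm : forall n, (0 < n)%N -> admissible R (Rs n) (Bs n).

(** One factor at a time is added by [spec_comp]. Membership of 0, obtained by translation, later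
    ensures that composing with such a set preserves the elements of the earlier spectrum. *)
Lemma fconv_spec m K : exists S, spec (fconv m K) S /\ 0 \in S.
Proof.
suff [S SF] : exists S, spec (fconv m K) S by exact: spec0 SF.
elim: K => [|K [S SF]].
  by exists [:: 0] => xi; rewrite big_seq1 /fconv big_nil csqn1.
have [T TG] := admissible_spec (Bs_adm (ltn0Sn (m + K))) (Bs_neq0 (ltn0Sn (m + K))).
eexists; apply: (spec_comp (P := tailprodZ m K) _ _ _ SF TG).
- by rewrite -tailprodE tailprod_unit.
- exact: fconv_periodic.
- by move=> xi; rewrite fconvS -tailprodE -fconv1_atoms -dft_map -tail_atoms_cat addn1.
Qed.

End Products.

(** * Passing to the weak limit *)

Section WeakLimit.
Local Open Scope complex_scope.
Variables (R : realType) (d : nat).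

Lemma cvgR_unique (u : nat -> R) (a b : R) : u @ \oo --> a -> u @ \oo --> b -> a = b.
Proof. by move=> ua ub; rewrite -(cvg_lim _ ua)// -(cvg_lim _ ub). Qed.

Lemma dotv_continuous (xi : 'cV[R]_d) : continuous (dotv xi).
Proof.
apply: continuous_big => [|i _ x]; first exact: add_continuous.
by apply: continuousM; [exact: cst_continuous|exact: coord_continuous].
Qed.

Lemma cos_dotv_continuous (xi : 'cV[R]_d) :
  continuous (fun x => cos (2 * pi * dotv xi x)).
Proof.
move=> x; apply: continuous_comp; last exact: continuous_cos.
by apply: continuousM; [exact: cst_continuous|exact: dotv_continuous].
Qed.

Lemma sin_dotv_continuous (xi : 'cV[R]_d) :
  continuous (fun x => sin (2 * pi * dotv xi x)).
Proof.
move=> x; apply: continuous_comp; last exact: continuous_sin.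
by apply: continuousM; [exact: cst_continuous|exact: dotv_continuous].
Qed.

Variables (Rs : nat -> 'M[int]_d) (Bs : nat -> seq 'cV[int]_d).

Lemma fconv_cvg m (mu : probability (Rd R d) R) xi : tail_conv_weakly_to Rs Bs m mu ->
  (fun K => complex.Re (fconv Rs Bs m K xi)) @ \oo --> complex.Re (fourier mu xi) /\
  (fun K => complex.Im (fconv Rs Bs m K xi)) @ \oo --> complex.Im (fourier mu xi).
Proof.
move=> wmu.
have fE K : fconv Rs Bs m K xi =
    (\prod_(A <- [seq tail_atoms R Rs Bs m k | k <- iota 1 K]) dft A xi) *
    cexp2pi (- dotv xi 0).
  by rewrite big_map dotv0r oppr0 cexp2pi0 mulr1.
split => /=.
- have -> : (fun K => complex.Re (fconv Rs Bs m K xi)) =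
      (fun K => tail_conv_int Rs Bs m K (fun x => cos (2 * pi * dotv xi x))).
    by apply/funext => K; rewrite fE /tail_conv_int (conv_int_fourier _ _ _).1.
  by apply: wmu; split; [exact: cos_dotv_continuous|exists 1 => x; exact: cos_max].
- have -> : (fun K => complex.Im (fconv Rs Bs m K xi)) =
      (fun K => - tail_conv_int Rs Bs m K (fun x => sin (2 * pi * dotv xi x))).
    by apply/funext => K; rewrite fE /tail_conv_int (conv_int_fourier _ _ _).2 opprK.
  apply: cvgN.
  by apply: wmu; split; [exact: sin_dotv_continuous|exists 1 => x; exact: sin_max].
Qed.

Lemma csqn_fconv_cvg m (mu : probability (Rd R d) R) xi : tail_conv_weakly_to Rs Bs m mu ->
  (fun K => csqn (fconv Rs Bs m K xi)) @ \oo --> csqn (fourier mu xi).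
Proof.
move=> /fconv_cvg -/(_ xi) [re im].
by rewrite /csqn !expr2; apply: cvgD; apply: cvgM.
Qed.

Lemma csqn_fourier_le1 m (mu : probability (Rd R d) R) xi :
  tail_conv_weakly_to Rs Bs m mu -> csqn (fourier mu xi) <= 1.
Proof.
move=> /csqn_fconv_cvg -/(_ xi) cvF; apply: (cvgr_to_le cvF).
by apply: nearW => K; exact: csqn_fconv_le1.
Qed.

(** The limit in [K] of the splitting [fconv_cat]: the factor of the first [n] convolutions is
    constant in [K], and the rest tends to the transform of the tail measure. *)
Lemma fourier_factor n (mu nu : probability (Rd R d) R) xi :
  (forall n, (0 < n)%N -> imx R (Rs n) \in unitmx) ->
  tail_conv_weakly_to Rs Bs 0 mu -> tail_conv_weakly_to Rs Bs n nu ->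
  fourier mu xi =
    fconv Rs Bs 0 n xi * fourier nu ((invmx (tailprod R Rs 0 n))^T *m xi).
Proof.
move=> Ru /fconv_cvg -/(_ xi)[re im].
set eta := _ *m xi => /fconv_cvg -/(_ eta)[re' im'].
set z := fconv Rs Bs 0 n xi.
have E K : fconv Rs Bs 0 (K + n) xi = z * fconv Rs Bs n K eta.
  by rewrite addnC fconv_cat.
apply/eqP; rewrite eq_complex; apply/andP; split; apply/eqP.
- apply: cvgR_unique (re) _; rewrite -(cvg_shiftn n) /=.
  have -> : (fun K => complex.Re (fconv Rs Bs 0 (K + n) xi)) = (fun K =>
     complex.Re z * complex.Re (fconv Rs Bs n K eta) -
     complex.Im z * complex.Im (fconv Rs Bs n K eta)).
    by apply/funext => K; rewrite E; case: (z) (fconv _ _ _ _ _) => [? ?] [? ?].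
  have -> : complex.Re (z * fourier nu eta) =
     complex.Re z * complex.Re (fourier nu eta) -
     complex.Im z * complex.Im (fourier nu eta).
    by case: (z) (fourier nu eta) => [? ?] [? ?].
  by apply: cvgB; apply: cvgMl_tmp.
- apply: cvgR_unique (im) _; rewrite -(cvg_shiftn n) /=.
  have -> : (fun K => complex.Im (fconv Rs Bs 0 (K + n) xi)) = (fun K =>
     complex.Re z * complex.Im (fconv Rs Bs n K eta) +
     complex.Im z * complex.Re (fconv Rs Bs n K eta)).
    by apply/funext => K; rewrite E; case: (z) (fconv _ _ _ _ _) => [? ?] [? ?].
  have -> : complex.Im (z * fourier nu eta) =
     complex.Re z * complex.Im (fourier nu eta) +
     complex.Im z * complex.Re (fourier nu eta).
    by case: (z) (fourier nu eta) => [? ?] [? ?].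
  by apply: cvgD; apply: cvgMl_tmp.
Qed.

(** Admissibility alone admits an empty digit set, the 0 by 0 matrix being unitary. An empty factor
    would make the partial integrals of the constant 1 eventually 0, whereas their limit is 1. *)
Lemma weak_limit_factor_neq_nil (mu : probability (Rd R d) R) n :
  tail_conv_weakly_to Rs Bs 0 mu -> (0 < n)%N -> Bs n != [::].
Proof.
move=> wmu n0; apply/eqP => Bn0.
have c0 (As : seq (seq 'cV[R]_d)) x : [::] \in As -> conv_int As (fun=> 1) x = 0.
  elim: As x => // A As IHAs x; rewrite inE => /orP[/eqP <- /=|Ain /=].
    by rewrite big_nil mulr0.
  by rewrite big1 ?mulr0// => a _; rewrite IHAs.
have : (fun K => tail_conv_int Rs Bs 0 K (fun=> 1)) @ \oo --> Rintegral mu setT (fun=> 1).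
  by apply: wmu; split; [exact: cst_continuous|exists 1 => x; rewrite normr1].
rewrite Rintegral_cst//= probability_setT mul1r -(cvg_shiftn n) /=.
have -> : (fun K => tail_conv_int Rs Bs 0 (K + n) (fun=> 1)) = fun=> 0 : R.
  apply/funext => K; rewrite /tail_conv_int c0//.
  apply/mapP; exists n; first by rewrite mem_iota n0 add1n ltnS leq_addl.
  by rewrite /tail_atoms add0n Bn0.
move=> c1; have /(_ _)/eqP := cvgR_unique c1 (cvg_cst (0 : R)).
by rewrite oner_eq0.
Qed.

End WeakLimit.

(** * Squared [L^2] norms of complex functions *)

Section SquareIntegral.
Local Open Scope complex_scope.
Context (disp : measure_display) (T : measurableType disp) (R : realType).
Variable mu : probability T R.
Implicit Types f g : T -> R[i].

Definition mfunC f :=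
  measurable_fun setT (fun x => complex.Re (f x)) /\
  measurable_fun setT (fun x => complex.Im (f x)).

Lemma mfunC_cst (c : R[i]) : mfunC (fun=> c).
Proof. by split; exact: measurable_cst. Qed.

Lemma mfunC_real (f : T -> R) : measurable_fun setT f -> mfunC (fun x => (f x)%:C).
Proof. by move=> mf; split => //=; exact: measurable_cst. Qed.

Lemma mfunCD f g : mfunC f -> mfunC g -> mfunC (fun x => f x + g x).
Proof.
move=> [rf jf] [rg jg]; split.
- have -> : (fun x => complex.Re (f x + g x)) =
    (fun x => complex.Re (f x) + complex.Re (g x)).
    by apply/funext => x; case: (f x) (g x) => [? ?] [? ?].
  exact: measurable_funD.
- have -> : (fun x => complex.Im (f x + g x)) =
    (fun x => complex.Im (f x) + complex.Im (g x)).
    by apply/funext => x; case: (f x) (g x) => [? ?] [? ?].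
  exact: measurable_funD.
Qed.

Lemma mfunCM f g : mfunC f -> mfunC g -> mfunC (fun x => f x * g x).
Proof.
move=> [rf jf] [rg jg]; split.
- have -> : (fun x => complex.Re (f x * g x)) =
    (fun x => complex.Re (f x) * complex.Re (g x) - complex.Im (f x) * complex.Im (g x)).
    by apply/funext => x; case: (f x) (g x) => [? ?] [? ?].
  by apply: measurable_funB; exact: measurable_funM.
- have -> : (fun x => complex.Im (f x * g x)) =
    (fun x => complex.Re (f x) * complex.Im (g x) + complex.Im (f x) * complex.Re (g x)).
    by apply/funext => x; case: (f x) (g x) => [? ?] [? ?].
  by apply: measurable_funD; exact: measurable_funM.
Qed.

Lemma mfunCB f g : mfunC f -> mfunC g -> mfunC (fun x => f x - g x).
Proof.
move=> mf mg; have := mfunCD mf (mfunCM (mfunC_cst (-1)) mg).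
by rewrite (_ : (fun x => f x + -1 * g x) = fun x => f x - g x)//; apply/funext => x; rewrite mulN1r.
Qed.

Definition sqint f : \bar R := (\int[mu]_x (csqn (f x))%:E)%E.

Lemma measurable_csqn f : mfunC f -> measurable_fun setT (fun x => (csqn (f x))%:E).
Proof.
move=> [rf jf]; apply/measurable_EFinP.
by apply: measurable_funD; exact: measurable_funX.
Qed.

Lemma sqint_le f (h : T -> \bar R) : mfunC f -> measurable_fun setT h ->
  (forall x, ((csqn (f x))%:E <= h x)%E) -> (sqint f <= \int[mu]_x h x)%E.
Proof.
move=> mf mh fh; apply: ge0_le_integral => //.
- by move=> x _; rewrite lee_fin csqn_ge0.
- exact: measurable_csqn.
Qed.

Lemma sqintD f g : mfunC f -> mfunC g ->
  (sqint (fun x => (f x + g x)%R) <= 2%:E * sqint f + 2%:E * sqint g)%E.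
Proof.
move=> mf mg; rewrite /sqint -!ge0_integralZl//; last first.
- by move=> x _; rewrite lee_fin csqn_ge0.
- exact: measurable_csqn.
- by move=> x _; rewrite lee_fin csqn_ge0.
- exact: measurable_csqn.
rewrite -ge0_integralD//.
- apply: sqint_le; first exact: mfunCD.
    by apply: emeasurable_funD; apply: measurable_funeM; exact: measurable_csqn.
  by move=> x; rewrite -!EFinM -EFinD lee_fin csqnD_le.
- by move=> x _; rewrite -EFinM lee_fin mulr_ge0 ?csqn_ge0.
- by apply: measurable_funeM; exact: measurable_csqn.
- by move=> x _; rewrite -EFinM lee_fin mulr_ge0 ?csqn_ge0.
- by apply: measurable_funeM; exact: measurable_csqn.
Qed.

Lemma sqintM f g (M : R) : mfunC f -> mfunC g -> 0 <= M ->
  (forall x, csqn (g x) <= M) ->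
  (sqint (fun x => (g x * f x)%R) <= M%:E * sqint f)%E.
Proof.
move=> mf mg M0 gM; rewrite /sqint -ge0_integralZl//.
- apply: sqint_le; first exact: mfunCM.
    by apply: measurable_funeM; exact: measurable_csqn.
  by move=> x; rewrite -EFinM lee_fin csqnM ler_wpM2r// csqn_ge0.
- exact: measurable_csqn.
- by move=> x _; rewrite lee_fin csqn_ge0.
Qed.

Lemma sqint_cvg0 (u : nat -> T -> R[i]) (h : T -> R) : (forall n, mfunC (u n)) ->
  mu.-integrable setT (EFin \o h) ->
  (forall n x, csqn (u n x) <= h x) ->
  (forall x, csqn (u n x) @[n --> \oo] --> 0) ->
  forall e : R, 0 < e -> exists n, (sqint (u n) < e%:E)%E.
Proof.
move=> mu_ ih uh u0 e e0.
have [] := @dominated_convergence _ _ _ mu setT measurableT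
  (fun n x => (csqn (u n x))%:E) (fun=> 0%E) (EFin \o h).
- by move=> n; exact: measurable_csqn.
- exact: measurable_cst.
- by apply: aeW => x _; apply: cvg_EFin; [exact: nearW|exact: u0].
- exact: ih.
- by apply: aeW => x n _ /=; rewrite lee_fin ger0_norm ?csqn_ge0.
move=> _ _; rewrite integral0 => /fine_cvgP[fin /cvgr_lt/(_ e e0) lt].
have [n [finn ltn]] := filter_ex (filterI fin lt).
by exists n; rewrite /sqint; move: finn ltn => /= finn; rewrite -lte_fin fineK.
Qed.

End SquareIntegral.

Import HBNNSimple.

(** * The [L^2] closure of a space of functions *)

Section L2Closure.
Local Open Scope complex_scope.
Context (disp : measure_display) (T : measurableType disp) (R : realType).
Variable mu : probability T R.
Variable A : set (T -> R[i]).
Implicit Types f g p q : T -> R[i].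

Hypothesis A_meas : forall p, A p -> mfunC p.
Hypothesis A_lin : forall (c : R[i]) p q, A p -> A q -> A (fun x => c * p x + q x).

Definition L2cl f := mfunC f /\
  forall e : R, 0 < e -> exists2 p, A p & (sqint mu (fun x => (f x - p x)%R) < e%:E)%E.

Lemma L2cl_sub p : A p -> L2cl p.
Proof.
move=> Ap; split; first exact: A_meas.
move=> e e0; exists p => //; rewrite /sqint.
under eq_integral do rewrite subrr csqn0.
by rewrite integral0.
Qed.

(** From [|u + v|^2 <= 2 |u|^2 + 2 |v|^2]; two errors below [e / 4] add up to less than [e]. *)
Lemma sqint_triangle f g h (e : R) : mfunC f -> mfunC g -> mfunC h ->
  (sqint mu (fun x => (f x - g x)%R) < (e / 4)%:E)%E ->
  (sqint mu (fun x => (g x - h x)%R) < (e / 4)%:E)%E ->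
  (sqint mu (fun x => (f x - h x)%R) < e%:E)%E.
Proof.
move=> mf mg mh fg gh.
have := sqintD mu (mfunCB mf mg) (mfunCB mg mh).
rewrite (_ : (fun x => _) = (fun x => f x - h x)); last first.
  by apply/funext => x; rewrite addrA subrK.
move=> /le_lt_trans; apply; rewrite (_ : e%:E = 2%:E * (e / 4)%:E + 2%:E * (e / 4)%:E)%E.
  by apply: lteD; rewrite lte_pmul2l.
by rewrite -!EFinM -EFinD; congr (_%:E); field.
Qed.

Lemma L2cl_closed f : mfunC f ->
  (forall e : R, 0 < e -> exists2 g, L2cl g & (sqint mu (fun x => (f x - g x)%R) < e%:E)%E) ->
  L2cl f.
Proof.
move=> mf cf; split => // e e0; have e40 : 0 < e / 4 by rewrite divr_gt0.
have [g [mg cg] fg] := cf _ e40; have [p Ap gp] := cg _ e40.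
by exists p => //; apply: (sqint_triangle (g := g)) => //; exact: A_meas.
Qed.

Lemma L2cl_lin (c : R[i]) f g : L2cl f -> L2cl g -> L2cl (fun x => c * f x + g x).
Proof.
move=> [mf cf] [mg cg]; have mcf := mfunCM (mfunC_cst T c) mf.
split; first exact: mfunCD.
move=> e e0.
(* Adding 1 makes the bound positive, so that it can be divided by even when [c = 0]. *)
pose M := csqn c + 1; have M0 : 0 < M by rewrite ltr_pwDr// csqn_ge0.
have e40 : 0 < e / 4 by rewrite divr_gt0.
have [p Ap fp] := cf (e / 4 / M) (divr_gt0 e40 M0).
have [q Aq gq] := cg _ e40.
have mp := A_meas Ap; have mq := A_meas Aq.
exists (fun x => c * p x + q x); first exact: A_lin.
apply: (sqint_triangle (g := fun x => c * p x + g x)).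
- exact: mfunCD.
- by apply: mfunCD => //; apply: mfunCM => //; exact: mfunC_cst.
- by apply: A_meas; exact: A_lin.
- rewrite (_ : (fun x => _) = (fun x => c * (f x - p x))); last first.
    by apply/funext => x; ring.
  apply: le_lt_trans (sqintM (M := M) mu (mfunCB mf mp) (mfunC_cst T c) (ltW M0) _) _.
    by move=> _; rewrite lerDl.
  by rewrite -[e / 4](mulfVK (lt0r_neq0 M0)) mulrC EFinM lte_pmul2l.
- rewrite (_ : (fun x => _) = (fun x => g x - q x))//.
  by apply/funext => x; ring.
Qed.

Lemma L2cl_sum (I : Type) (s : seq I) (c : I -> R[i]) (f : I -> T -> R[i]) :
  A (fun=> 0) -> (forall i, L2cl (f i)) -> L2cl (fun x => \sum_(i <- s) c i * f i x).
Proof.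
move=> A0 cf; elim: s => [|i s IHs].
  rewrite (_ : (fun x => _) = fun=> 0); first exact: L2cl_sub.
  by apply/funext => x; rewrite big_nil.
rewrite (_ : (fun x => _) = fun x => c i * f i x + \sum_(i <- s) c i * f i x).
  exact: L2cl_lin.
by apply/funext => x; rewrite big_cons.
Qed.

Hypothesis A_mul : forall p q, A p -> A q -> A (fun x => p x * q x).
Hypothesis A_bnd : forall p, A p -> exists2 M : R, 0 < M & forall x, csqn (p x) <= M.

(** The splitting is [f g - p q = g (f - p) + p (g - q)]. The accuracy of [q] depends on the bound
    for [p], so [p] is chosen first. *)
Lemma L2cl_mul f g (M : R) : 0 < M -> (forall x, csqn (g x) <= M) ->
  L2cl f -> L2cl g -> L2cl (fun x => f x * g x).
Proof.
move=> M0 gM [mf cf] [mg cg]; split; first exact: mfunCM.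
move=> e e0; have e40 : 0 < e / 4 by rewrite divr_gt0.
have [p Ap fp] := cf (e / 4 / M) (divr_gt0 e40 M0).
have [N N0 pN] := A_bnd Ap.
have [q Aq gq] := cg (e / 4 / N) (divr_gt0 e40 N0).
have mp := A_meas Ap; have mq := A_meas Aq.
exists (fun x => p x * q x); first exact: A_mul.
apply: (sqint_triangle (g := fun x => p x * g x)); try exact: mfunCM.
- rewrite (_ : (fun x => _) = (fun x => g x * (f x - p x))); last first.
    by apply/funext => x; ring.
  apply: le_lt_trans (sqintM (M := M) mu (mfunCB mf mp) mg (ltW M0) gM) _.
  by rewrite -[e / 4](mulfVK (lt0r_neq0 M0)) mulrC EFinM lte_pmul2l.
- rewrite (_ : (fun x => _) = (fun x => p x * (g x - q x))); last first.
    by apply/funext => x; ring.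
  apply: le_lt_trans (sqintM (M := N) mu (mfunCB mg mq) mp (ltW N0) pN) _.
  by rewrite -[e / 4](mulfVK (lt0r_neq0 N0)) mulrC EFinM lte_pmul2l.
Qed.

(** * The algebra of bounded real functions in the closure *)

Hypothesis A_cst : forall c : R[i], A (fun=> c).

Definition rcl (f : T -> R) :=
  (exists M : R, forall x, `|f x| <= M) /\ L2cl (fun x => (f x)%:C).

Lemma rcl_cst (c : R) : rcl (fun=> c).
Proof. by split; [exists (`|c|)|exact: L2cl_sub]. Qed.

Lemma rcl_lin (c : R) (f g : T -> R) : rcl f -> rcl g -> rcl (fun x => c * f x + g x).
Proof.
move=> [[M fM] cf] [[N gN] cg]; split.
  exists (`|c| * M + N) => x; rewrite (le_trans (ler_normD _ _))// lerD//.
  by rewrite normrM ler_wpM2l.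
rewrite (_ : (fun x => _) = fun x => c%:C * (f x)%:C + (g x)%:C); first exact: L2cl_lin.
by apply/funext => x; rewrite rmorphD rmorphM.
Qed.

Lemma rclD (f g : T -> R) : rcl f -> rcl g -> rcl (fun x => f x + g x).
Proof.
move=> cf cg; have := rcl_lin 1 cf cg.
by rewrite (_ : (fun x => _) = fun x => f x + g x)//; apply/funext => x; rewrite mul1r.
Qed.

Lemma rclB (f g : T -> R) : rcl f -> rcl g -> rcl (fun x => f x - g x).
Proof.
move=> cf cg; have := rcl_lin (-1) cg cf.
by rewrite (_ : (fun x => _) = fun x => f x - g x)//; apply/funext => x; rewrite mulN1r addrC.
Qed.

Lemma rclM (f g : T -> R) : rcl f -> rcl g -> rcl (fun x => f x * g x).
Proof.
move=> [[M fM] cf] [[N gN] cg]; split.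
  by exists (M * N) => x; rewrite normrM ler_pM.
rewrite (_ : (fun x => _) = fun x => (f x)%:C * (g x)%:C); last first.
  by apply/funext => x; rewrite rmorphM.
apply: (L2cl_mul (M := N ^+ 2 + 1)) => //.
  by rewrite ltr_pwDr// sqr_ge0.
move=> x; rewrite csqn_real ler_wpDr// -[leLHS]ger0_norm ?sqr_ge0// normrX.
by rewrite lerXn2r// nnegrE (le_trans _ (gN x)).
Qed.

Lemma rclX (f : T -> R) n : rcl f -> rcl (fun x => f x ^+ n).
Proof.
move=> cf; elim: n => [|n IHn]; first exact: rcl_cst.
rewrite (_ : (fun x => _) = fun x => f x * f x ^+ n); first exact: rclM.
by apply/funext => x; rewrite exprS.
Qed.

Lemma rcl_lim (u : nat -> T -> R) (f : T -> R) (M : R) :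
  (forall n, rcl (u n)) -> (forall n x, `|u n x| <= M) ->
  (forall x, u n x @[n --> \oo] --> f x) -> rcl f.
Proof.
move=> cu uM uf.
have mU n : measurable_fun setT (u n) by case: (cu n) => _ [] [].
have fM x : `|f x| <= M.
  by apply: (cvgr_to_le (cvg_norm (uf x))); apply: nearW => n; exact: uM.
have mf : measurable_fun setT f by apply: (measurable_fun_cvg mU) => x _; exact: uf.
split; first by exists M.
apply: L2cl_closed; first exact: mfunC_real.
move=> e e0.
have [n fn] : exists n, (sqint mu (fun x => ((f x)%:C - (u n x)%:C)%R) < e%:E)%E.
  (* Both functions are bounded by [M], so their squared difference is at most [(2 M)^2], which is
     integrable for a probability. *)
  apply: (sqint_cvg0 (h := fun=> 4 * M ^+ 2)) => //.
  - by move=> n; apply: mfunCB; exact: mfunC_real.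
  - apply: measurable_bounded_integrable => //.
      by rewrite (le_lt_trans (probability_le1 _ _))// ltry.
    exact: bounded_cst.
  - move=> n x; rewrite -rmorphB csqn_real.
    have := fM x; have := uM n x; rewrite !ler_norml => /andP[? ?] /andP[? ?].
    nra.
  - move=> x; rewrite (_ : (fun n => _) = fun n => (f x - u n x) ^+ 2); last first.
      by apply/funext => n; rewrite -rmorphB csqn_real.
    rewrite [X in _ --> X](_ : _ = (f x - f x) ^+ 2); last by rewrite subrr expr0n.
    rewrite expr2; under eq_fun do rewrite expr2.
    by apply: cvgM; apply: cvgB => //; exact: cvg_cst.
by exists (fun x => (u n x)%:C) => //; case: (cu n).
Qed.

(** The iteration [p + (a^2 - p^2) / 2], known from the Stone-Weierstrass theorem: polynomials in
    [a] that tend to [|a|] on [[-1, 1]]. *)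
Fixpoint absapprox (a : R) (n : nat) : R :=
  if n is n'.+1 then absapprox a n' + 2^-1 * (a ^+ 2 - absapprox a n' ^+ 2) else 0.

(** The error obeys [|a| - p' = (|a| - p) (1 - (|a| + p) / 2)]; the second factor lies between 0 and
    [1 - |a| / 2]. *)
Lemma absapprox_bound a n : `|a| <= 1 ->
  [/\ 0 <= absapprox a n, absapprox a n <= `|a| &
      `|a| - absapprox a n <= `|a| * (1 - `|a| / 2) ^+ n].
Proof.
move=> a1; elim: n => [|n [p0 pa ap]] /=; first by rewrite lexx normr_ge0 expr0 mulr1 subr0.
rewrite -(real_normK (num_real a)).
set b := `|a| in a1 pa ap *; have b0 : 0 <= b := normr_ge0 a.
set p := absapprox a n in p0 pa ap *.
split.
- nra.
- nra.
- rewrite (exprSr (1 - b / 2)) mulrA (@le_trans _ _ ((b - p) * (1 - b / 2)))//; first by nra.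
  by rewrite ler_wpM2r//; nra.
Qed.

Lemma absapprox_cvg a : `|a| <= 1 -> absapprox a n @[n --> \oo] --> `|a|.
Proof.
move=> a1; have [->|a0] := eqVneq a 0.
  rewrite normr0; have -> : absapprox 0 = fun=> 0.
    apply/funext; elim=> //= n ->.
    by rewrite expr0n /= subr0 mulr0 addr0.
  exact: cvg_cst.
have b0 : 0 < `|a| by rewrite normr_gt0.
apply: (@squeeze_cvgr _ _ _ _ (fun n => `|a| - `|a| * (1 - `|a| / 2) ^+ n) (fun=> `|a|)).
- apply: nearW => n; have [_ -> h] := absapprox_bound n a1.
  by rewrite andbT lerBlDr addrC -lerBlDr.
- rewrite -[X in _ --> X]subr0 -[X in _ --> _ - X](mulr0 `|a|).
  apply: cvgB; first exact: cvg_cst.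
  apply: cvgMl_tmp; apply: cvg_expr.
  by rewrite ger0_norm; lra.
- exact: cvg_cst.
Qed.

Lemma rcl_abs (g : T -> R) : (forall x, `|g x| <= 1) -> rcl g -> rcl (fun x => `|g x|).
Proof.
move=> g1 cg; apply: (rcl_lim (u := fun n x => absapprox (g x) n) (M := 1)).
- elim=> [|n IHn] /=; first exact: rcl_cst.
  by apply: rclD => //; apply: rclM; [exact: rcl_cst|apply: rclB; exact: rclX].
- move=> n x; have [p0 pa _] := absapprox_bound n (g1 x).
  by rewrite ger0_norm// (le_trans pa).
- by move=> x; exact: absapprox_cvg.
Qed.

(** With [h] the positive part of [g], which lies in [[0, 1]], the powers [(1 - h)^n] tend to 0
    where [g > 0] and equal 1 elsewhere. *)
Lemma rcl_gt0 (g : T -> R) : (forall x, `|g x| <= 1) -> rcl g ->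
  rcl (fun x => (0 < g x)%R%:R).
Proof.
move=> g1 cg; pose h x := 2^-1 * (`|g x| + g x).
have ch : rcl h by apply: rclM; [exact: rcl_cst|apply: rclD => //; exact: rcl_abs].
have h01 x : 0 <= h x <= 1.
  have := g1 x; rewrite ler_norml => /andP[? ?]; rewrite /h.
  by have [g0|g0] := leP 0 (g x); [rewrite ger0_norm//|rewrite ltr0_norm//]; apply/andP; split; lra.
apply: (rcl_lim (u := fun n x => 1 - (1 - h x) ^+ n) (M := 1)).
- move=> n; apply: rclB; first exact: rcl_cst.
  by apply: rclX; apply: rclB => //; exact: rcl_cst.
- move=> n x; have /andP[h0 h1] := h01 x.
  have : 0 <= (1 - h x) ^+ n <= 1 by rewrite exprn_ge0 ?exprn_ile1//; lra.
  by move=> /andP[? ?]; rewrite ger0_norm; lra.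
- move=> x; have /andP[h0 h1] := h01 x; have [g0|g0] := ltP 0 (g x).
    rewrite -[X in _ --> X]subr0; apply: cvgB; first exact: cvg_cst.
    apply: cvg_expr; rewrite /h ger0_norm gtr0_norm//.
      by lra.
    by move: h1; rewrite /h gtr0_norm//; lra.
  have -> : (fun n => 1 - (1 - h x) ^+ n) = fun=> 0.
    by apply/funext => n; rewrite /h ler0_norm// addNr mulr0 subr0 expr1n subrr.
  exact: cvg_cst.
Qed.

Definition rcl_sets : set (set T) := [set B | rcl (\1_B : T -> R)].

Lemma rcl_sets_setI B C : rcl_sets B -> rcl_sets C -> rcl_sets (B `&` C).
Proof.
move=> cB cC; rewrite /rcl_sets /= (_ : \1_(B `&` C) = fun x => \1_B x * \1_C x).
  exact: rclM.
by apply/funext => x; rewrite !indicE in_setI -natrM mulnb.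
Qed.

Lemma rcl_sets_setC B : rcl_sets B -> rcl_sets (~` B).
Proof.
move=> cB; rewrite /rcl_sets /= (_ : \1_(~` B) = fun x => 1 - \1_B x).
  by apply: rclB => //; exact: rcl_cst.
by apply/funext => x; rewrite !indicE in_setC; case: (x \in B); rewrite ?subrr ?subr0.
Qed.

Lemma rcl_sets_bigcup (B : nat -> set T) :
  (forall n, rcl_sets (B n)) -> rcl_sets (\bigcup_n B n).
Proof.
(* [u n] is the indicator of the union of the first [n] sets, written as a polynomial in their
   indicators; at each point it is eventually constant. *)
move=> cB; pose u n x : R := 1 - \prod_(k < n) (1 - \1_(B k) x).
have prod01 n x : 0 <= \prod_(k < n) (1 - \1_(B k) x : R) <= 1.
  have b01 (k : 'I_n) : 0 <= (1 - \1_(B k) x : R) <= 1.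
    by rewrite indicE; case: (_ \in _); rewrite ?subrr ?subr0 lexx ler01.
  by rewrite prodr_ge0 ?prodr_ile1// => k _; case/andP: (b01 k).
apply: (rcl_lim (u := u) (M := 1)).
- move=> n; apply: rclB; first exact: rcl_cst.
  elim: n => [|n IHn].
    rewrite (_ : (fun x => _) = fun=> 1); first exact: rcl_cst.
    by apply/funext => x; rewrite big_ord0.
  rewrite (_ : (fun x => _) = fun x => \prod_(k < n) (1 - \1_(B k) x) * (1 - \1_(B n) x)).
    by apply: rclM => //; apply: rclB; [exact: rcl_cst|exact: cB].
  by apply/funext => x; rewrite big_ord_recr.
- by move=> n x; have /andP[? ?] := prod01 n x; rewrite /u ger0_norm; lra.
- move=> x; apply: cvg_near_cst.
  have [[k _ Bkx]|nBx] := pselect ((\bigcup_n B n) x).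
    exists k.+1 => // n /= kn; rewrite /u indicE mem_set; last by exists k.
    rewrite (bigD1 (Ordinal kn))//= indicE mem_set//.
    by rewrite subrr mul0r subr0.
  exists 0%N => // n _; rewrite /u indicE memNset// big1 ?subrr// => k _.
  by rewrite indicE memNset ?subr0// => Bkx; apply: nBx; exists k.
Qed.

Lemma rcl_sets_sigma_algebra : sigma_algebra setT rcl_sets.
Proof.
split=> [|B cB|B cB].
- by rewrite /rcl_sets /= indic0; exact: rcl_cst.
- by rewrite setTD; exact: rcl_sets_setC.
- exact: rcl_sets_bigcup.
Qed.

(** * From indicators to all square-integrable functions *)

Hypothesis A_sets : forall B, measurable B -> rcl_sets B.

Lemma L2cl_nnsfun (h : {nnsfun T >-> R}) : L2cl (fun x => (h x)%:C).
Proof.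
rewrite (_ : (fun x => _) = fun x =>
    \sum_(y <- finmap.enum_fset (fset_set (range h))) y%:C * (\1_(h @^-1` [set y]) x)%:C); last first.
  apply/funext => x; rewrite {1}(fimfunE h) fsbig_finite//= rmorph_sum.
  by apply: eq_bigr => y _; rewrite rmorphM.
by apply: L2cl_sum => // y; case: (A_sets (measurable_sfunP h (measurable_set1 y))).
Qed.

(** Simple functions [u n] increase to [g], so [|g - u n|^2 <= g^2] and dominated convergence
    applies. *)
Lemma L2cl_ge0 (g : T -> R) : measurable_fun setT g -> (forall x, 0 <= g x) ->
  (\int[mu]_x (g x ^+ 2)%:E < +oo)%E -> L2cl (fun x => (g x)%:C).
Proof.
move=> mg g0 ig; apply: L2cl_closed; first exact: mfunC_real.
move=> e e0.
have mEg : measurable_fun setT (EFin \o g) by exact/measurable_EFinP.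
pose u := nnsfun_approx measurableT mEg.
have ucv x : u n x @[n --> \oo] --> g x.
  have /fine_cvgP[_] := cvg_nnsfun_approx measurableT mEg (fun x _ => g0 x) (x := x) I.
  by [].
have ug n x : u n x <= g x.
  rewrite -(cvg_lim (@Rhausdorff R) (ucv x)).
  apply: nondecreasing_cvgn_le; last exact: cvgP (ucv x).
  by move=> m k mk; exact/lefP/nd_nnsfun_approx.
have [n fn] : exists n, (sqint mu (fun x => ((g x)%:C - (u n x)%:C)%R) < e%:E)%E.
  apply: (sqint_cvg0 (h := fun x => g x ^+ 2)) => //.
  - by move=> n; apply: mfunCB; exact: mfunC_real.
  - apply/integrableP; split; first by apply/measurable_EFinP; exact: measurable_funX.
    by under eq_integral do rewrite /= ger0_norm ?sqr_ge0//.
  - move=> n x; rewrite -rmorphB csqn_real.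
    have := ug n x; have : 0 <= u n x by []; nra.
  - move=> x; rewrite (_ : (fun n => _) = fun n => (g x - u n x) ^+ 2); last first.
      by apply/funext => n; rewrite -rmorphB csqn_real.
    rewrite [X in _ --> X](_ : _ = (g x - g x) ^+ 2); last by rewrite subrr expr0n.
    rewrite expr2; under eq_fun do rewrite expr2.
    by apply: cvgM; apply: cvgB => //; exact: cvg_cst.
by exists (fun x => (u n x)%:C) => //; exact: L2cl_nnsfun.
Qed.

Lemma L2cl_real (g : T -> R) : measurable_fun setT g ->
  (\int[mu]_x (g x ^+ 2)%:E < +oo)%E -> L2cl (fun x => (g x)%:C).
Proof.
move=> mg ig.
have sq (h : T -> R) : measurable_fun setT h -> (forall x, h x ^+ 2 <= g x ^+ 2) ->
    (\int[mu]_x (h x ^+ 2)%:E < +oo)%E.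
  move=> mh hg; apply: le_lt_trans ig; apply: ge0_le_integral => //.
  - by move=> x _; rewrite lee_fin sqr_ge0.
  - by apply/measurable_EFinP; exact: measurable_funX.
  - by apply/measurable_EFinP; exact: measurable_funX.
  - by move=> x _; rewrite lee_fin.
have mp : measurable_fun setT (fun x => Num.max (g x) 0).
  exact: measurable_maxr.
have mn : measurable_fun setT (fun x => Num.max (- g x) 0).
  by apply: measurable_maxr => //; exact: measurable_funN.
have cp : L2cl (fun x => (Num.max (g x) 0)%:C).
  apply: L2cl_ge0 => //; first by move=> x; rewrite le_max lexx orbT.
  by apply: sq => // x; rewrite maxEle; case: ifP => _; rewrite ?expr0n /= ?sqr_ge0 ?lexx.
have cn : L2cl (fun x => (Num.max (- g x) 0)%:C).
  apply: L2cl_ge0 => //; first by move=> x; rewrite le_max lexx orbT.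
  by apply: sq => // x; rewrite maxEle; case: ifP => _; rewrite ?sqrrN ?expr0n /= ?sqr_ge0 ?lexx.
rewrite (_ : (fun x => _) = fun x =>
  (-1) * (Num.max (- g x) 0)%:C + (Num.max (g x) 0)%:C); first exact: L2cl_lin.
apply/funext => x; rewrite -(rmorphN1 (@real_complex R)) -rmorphM -rmorphD; congr (_%:C).
by rewrite mulN1r; case: leP => h1; case: leP => h2; lra.
Qed.

Lemma L2cl_full f : mfunC f -> (sqint mu f < +oo)%E -> L2cl f.
Proof.
move=> mf jf.
have part (h : T -> R) : measurable_fun setT h -> (forall x, h x ^+ 2 <= csqn (f x)) ->
    L2cl (fun x => (h x)%:C).
  move=> mh hf; apply: L2cl_real => //; apply: le_lt_trans jf; apply: ge0_le_integral => //.
  - by move=> x _; rewrite lee_fin sqr_ge0.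
  - by apply/measurable_EFinP; exact: measurable_funX.
  - exact: measurable_csqn.
  - by move=> x _; rewrite lee_fin.
rewrite (_ : f = fun x => 'i%C * (complex.Im (f x))%:C + (complex.Re (f x))%:C).
  case: mf => mr mi.
  by apply: L2cl_lin; apply: part => // x; rewrite /csqn ?lerDl ?lerDr ?sqr_ge0.
apply/funext => x; case: (f x) => a b; apply/eqP; rewrite eq_complex /=.
by rewrite !(mul0r, mul1r, mulr0, sub0r, subr0, add0r, addr0, oppr0) !eqxx.
Qed.

End L2Closure.

(** * Trigonometric polynomials are dense in [L^2(mu)] *)

Section TrigonometricPolynomials.
Local Open Scope complex_scope.
Variables (R : realType) (d : nat).
Implicit Types (xi eta x : 'cV[R]_d) (S : set 'cV[R]_d).

Lemma continuous_Rd_measurable (f : 'cV[R]_d -> R) : continuous f ->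
  measurable_fun (setT : set (Rd R d)) (f : Rd R d -> R).
Proof.
move=> cf; apply: (measurability _ (RGenOpens.measurableE R)) => _ [_ [a [b ->]] <-].
rewrite setTI; apply: sub_sigma_algebra; apply: open_comp => //.
Qed.

Lemma mfunC_expo xi : @mfunC _ (Rd R d) R (expo xi).
Proof.
split; apply: continuous_Rd_measurable.
- exact: cos_dotv_continuous.
- exact: sin_dotv_continuous.
Qed.

Lemma expoD xi eta x : expo (xi + eta) x = expo xi x * expo eta x.
Proof. by rewrite /expo dotvDl cexp2piD. Qed.

Definition trigpoly (l : seq (R[i] * 'cV[R]_d)) x : R[i] :=
  \sum_(a <- l) a.1 * expo a.2 x.

Definition trigset S : set ('cV[R]_d -> R[i]) :=
  [set p | exists2 l, (forall a, a \in l -> S a.2) & p = trigpoly l].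

Lemma trigset_meas S p : trigset S p -> @mfunC _ (Rd R d) R p.
Proof.
move=> [l _ ->]; elim: l => [|a l IHl].
  rewrite (_ : trigpoly _ = fun=> 0); first exact: mfunC_cst.
  by apply/funext => x; rewrite /trigpoly big_nil.
rewrite (_ : trigpoly _ = fun x => a.1 * expo a.2 x + trigpoly l x).
  by apply: mfunCD => //; apply: mfunCM; [exact: mfunC_cst|exact: mfunC_expo].
by apply/funext => x; rewrite /trigpoly big_cons.
Qed.

Lemma trigset_lin S (c : R[i]) p q : trigset S p -> trigset S q ->
  trigset S (fun x => c * p x + q x).
Proof.
move=> [l Sl ->] [m Sm ->]; exists ([seq (c * a.1, a.2) | a <- l] ++ m).
  by move=> a; rewrite mem_cat => /orP[/mapP[b /Sl Sb ->]|/Sm].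
apply/funext => x; rewrite /trigpoly big_cat big_map mulr_sumr; congr (_ + _).
by apply: eq_bigr => a _; rewrite mulrA.
Qed.

Lemma trigset0 S : trigset S (fun=> 0).
Proof. by exists [::] => //; apply/funext => x; rewrite /trigpoly big_nil. Qed.

Lemma trigset_mul p q : trigset setT p -> trigset setT q ->
  trigset setT (fun x => p x * q x).
Proof.
move=> [l _ ->] [m _ ->].
exists [seq (a.1 * b.1, a.2 + b.2) | a <- l, b <- m] => //.
apply/funext => x; rewrite /trigpoly big_allpairs_dep mulr_suml.
apply: eq_bigr => a _; rewrite mulr_sumr; apply: eq_bigr => b _ /=.
by rewrite expoD mulrACA.
Qed.

Lemma trigset_bnd S p : trigset S p ->
  exists2 M : R, 0 < M & forall x, csqn (p x) <= M.
Proof.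
move=> [l _ ->]; elim: l => [|a l [M M0 lM]].
  by exists 1 => // x; rewrite /trigpoly big_nil csqn0 ler01.
exists (2 * csqn a.1 + 2 * M).
  by rewrite ltr_wpDl ?mulr_ge0 ?csqn_ge0 ?mulr_gt0.
move=> x; rewrite /trigpoly big_cons (le_trans (csqnD_le _ _))// lerD//.
  by rewrite csqnM csqn_cexp2pi mulr1.
by rewrite ler_pM2l//; exact: lM.
Qed.

Lemma trigset_cst (c : R[i]) : trigset setT (fun=> c).
Proof.
exists [:: (c, 0)] => //; apply/funext => x.
by rewrite /trigpoly big_seq1 /= /expo dotv0l cexp2pi0 mulr1.
Qed.

(** Terms of equal frequency are merged, since [spectrum] asks for coefficients given as a function
    of the frequency. *)
Lemma trigpoly_collect l : exists c : 'cV[R]_d -> R[i],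
  trigpoly l = fun x => \sum_(xi <- undup (unzip2 l)) c xi * expo xi x.
Proof.
exists (fun xi => \sum_(a <- l | a.2 == xi) a.1).
apply/funext => x; under [RHS]eq_bigr do rewrite mulr_suml.
rewrite (exchange_big_dep xpredT)//=; apply: eq_big_seq => a al.
rewrite big_mkcond (bigD1_seq a.2) ?undup_uniq ?mem_undup ?map_f//= eqxx.
by rewrite big1 ?addr0// => xi; rewrite eq_sym => /negbTE ->.
Qed.

Variable mu : probability (Rd R d) R.

Local Notation rclR := (rcl (T := Rd R d) mu (trigset setT)).
Local Notation rcl_setsR := (rcl_sets (T := Rd R d) mu (trigset setT)).

Lemma rcl_cos xi : rclR (fun x => cos (2 * pi * dotv xi x)).
Proof.
split; first by exists 1 => x; exact: cos_max.
apply: L2cl_sub; first exact: trigset_meas.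
exists [:: (2^-1, xi); (2^-1, - xi)] => //; apply/funext => x.
rewrite /trigpoly big_cons big_seq1 /= -mulrDr /expo dotvNl cexp2piN.
apply: (mulfI (_ : 2 != 0)); first by rewrite pnatr_eq0.
rewrite mulrA divff ?pnatr_eq0// mul1r mulr2n mulrDl mul1r.
by apply/eqP; rewrite eq_complex /= subrr addr0 !eqxx.
Qed.

Lemma rcl_sin xi : rclR (fun x => sin (2 * pi * dotv xi x)).
Proof.
split; first by exists 1 => x; exact: sin_max.
apply: L2cl_sub; first exact: trigset_meas.
pose w : R[i] := 0 -i* 2^-1.
exists [:: (w, xi); (- w, - xi)] => //; apply/funext => x.
rewrite /trigpoly big_cons big_seq1 /= /expo dotvNl cexp2piN /w.
by apply/eqP; rewrite eq_complex /=; apply/andP; split; apply/eqP; field.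
Qed.

(** The function [sin ((x_i - a) / (n + 1))] is a trigonometric polynomial, and has the sign of
    [x_i - a] as soon as [|x_i - a| < pi (n + 1)]. The indicators of its positivity sets therefore
    converge pointwise to that of the half-space. *)
Lemma rcl_halfspace (i : 'I_d) (a : R) : rcl_setsR [set x : Rd R d | a < x i 0].
Proof.
pose g n x : R := sin ((x i 0 - a) / n.+1%:R).
have cg n : rclR (g n).
  (* This frequency makes [2 pi xi . x] equal to [x_i / (n + 1)]; the subtraction formula for the
     sine then removes [a]. *)
  pose xi : 'cV[R]_d := (2 * pi * n.+1%:R)^-1 *: delta_mx i 0.
  have E x : 2 * pi * dotv xi x = x i 0 / n.+1%:R.
    rewrite /dotv (bigD1 i)//= big1 => [|k ki]; last first.
      by rewrite !mxE (negbTE ki) mulr0 mul0r.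
    rewrite !mxE !eqxx mulr1 addr0.
    have : n.+1%:R != 0 :> R by rewrite pnatr_eq0.
    have : pi != 0 :> R by rewrite lt0r_neq0 ?pi_gt0.
    by move: (n.+1%:R : R) (pi : R) => N p p0 N0; field; rewrite p0 N0.
  rewrite (_ : g n = fun x => cos (a / n.+1%:R) * sin (2 * pi * dotv xi x) -
      sin (a / n.+1%:R) * cos (2 * pi * dotv xi x)).
    apply: rclB; [exact: trigset_meas|exact: trigset_lin| |].
    - apply: rclM; [exact: trigset_meas|exact: trigset_mul|exact: trigset_bnd| |].
        by apply: rcl_cst; [exact: trigset_meas|exact: trigset_cst].
      exact: rcl_sin.
    - apply: rclM; [exact: trigset_meas|exact: trigset_mul|exact: trigset_bnd| |].
        by apply: rcl_cst; [exact: trigset_meas|exact: trigset_cst].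
      exact: rcl_cos.
  by apply/funext => x; rewrite !E /g mulrBl sinB; ring.
rewrite /rcl_sets /=; apply: (rcl_lim (T := Rd R d) (@trigset_meas setT) (u := fun n x => (0 < g n x)%R%:R) (M := 1)).
- move=> n; apply: rcl_gt0 => //.
  + exact: trigset_meas.
  + exact: trigset_lin.
  + exact: trigset_mul.
  + exact: trigset_bnd.
  + exact: trigset_cst.
  + by move=> x; exact: sin_max.
- by move=> n x; case: (0 < g n x); rewrite ?normr1 ?normr0.
- move=> x; apply: cvg_near_cst.
  pose t := x i 0 - a; pose N := Num.bound (`|t| / pi).
  have tN n : (N <= n)%N -> `|t| / n.+1%:R < pi.
    move=> Nn; rewrite ltr_pdivrMr ?ltr0n// mulrC -ltr_pdivrMr ?pi_gt0//.
    rewrite (lt_le_trans (archi_boundP _))//; first by rewrite divr_ge0 ?pi_ge0.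
    by rewrite ler_nat (leq_trans Nn).
  exists N => // n /= /tN tn; rewrite indicE.
  have [ax|xa] := ltP a (x i 0).
    rewrite mem_set//= /g -/t.
    have t0 : 0 < t by rewrite subr_gt0.
    rewrite sin_gt0_pi// divr_gt0 ?ltr0n//=.
    by move: tn; rewrite gtr0_norm.
  rewrite memNset; last by apply/negP; rewrite -leNgt.
  rewrite ltNge /g -/t.
  have t0 : t <= 0 by rewrite subr_le0.
  suff -> : sin (t / n.+1%:R) <= 0 by [].
  rewrite -[t]opprK mulNr sinN oppr_le0 sin_ge0_pi//.
  by rewrite divr_ge0 ?oppr_ge0//=; move: tn; rewrite ler0_norm// => /ltW.
Qed.

(** Half-open boxes are intersections of half-spaces and complements of half-spaces; rational
    centres make the family countable. *)
Definition ratbox (c : 'cV[rat]_d) (n : nat) : set (Rd R d) :=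
  [set x | forall i, ratr (c i 0) - n.+1%:R^-1 < x i 0 <= ratr (c i 0) + n.+1%:R^-1].

Lemma rcl_ratbox c n : rcl_setsR (ratbox c n).
Proof.
have key (s : seq 'I_d) : rcl_setsR [set x : Rd R d | forall i, i \in s ->
    ratr (c i 0) - n.+1%:R^-1 < x i 0 <= ratr (c i 0) + n.+1%:R^-1].
  elim: s => [|i s IHs].
    rewrite (_ : [set x : Rd R d | _] = setT); last by apply/seteqP; split.
    rewrite /rcl_sets /= indicT.
    by apply: rcl_cst; [exact: trigset_meas|exact: trigset_cst].
  rewrite (_ : [set x : Rd R d | _] =
    ([set x : Rd R d | ratr (c i 0) - n.+1%:R^-1 < x i 0] `&`
    ~` [set x : Rd R d | ratr (c i 0) + n.+1%:R^-1 < x i 0]) `&`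
    [set x : Rd R d | forall i, i \in s ->
      ratr (c i 0) - n.+1%:R^-1 < x i 0 <= ratr (c i 0) + n.+1%:R^-1]).
    apply: rcl_sets_setI => //; [exact: trigset_meas|exact: trigset_mul|exact: trigset_bnd|].
    apply: rcl_sets_setI; [exact: trigset_meas|exact: trigset_mul|exact: trigset_bnd| |].
      exact: rcl_halfspace.
    apply: rcl_sets_setC; [exact: trigset_meas|exact: trigset_lin|exact: trigset_cst|].
    exact: rcl_halfspace.
  apply/seteqP; split => x /=.
  - move=> h; split; last by move=> k ks; apply: h; rewrite inE ks orbT.
    have /andP[? ?] := h i (mem_head _ _).
    by split => //; apply/negP; rewrite -leNgt.
  - move=> [[h1 /negP h2] h k]; rewrite inE => /orP[/eqP ->|]; last exact: h.
    by rewrite h1 /= leNgt.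
rewrite (_ : ratbox c n = [set x : Rd R d | forall i, i \in enum 'I_d ->
    ratr (c i 0) - n.+1%:R^-1 < x i 0 <= ratr (c i 0) + n.+1%:R^-1]); first exact: key.
by apply/seteqP; split => x /= h i; [move=> _|]; apply: h; rewrite ?mem_enum.
Qed.

(** An open set is the countable union of the rational boxes it contains. Codes of no box, or of a
    box not inside [U], contribute the empty set. *)
Lemma rcl_open (U : set 'cV[R]_d) : open U -> rcl_setsR U.
Proof.
move=> oU.
pose B (k : nat) : set (Rd R d) :=
  if @unpickle ('cV[rat]_d * nat)%type k is Some cn then
    [set x | ratbox cn.1 cn.2 `<=` U /\ ratbox cn.1 cn.2 x] else set0.
have -> : U = \bigcup_k B k.
  apply/seteqP; split => x; last by move=> [k _]; rewrite /B; case: unpickle => // cn [/[apply]].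
  move=> Ux; have : nbhs x U by apply: open_nbhs_nbhs.
  move=> /nbhs_ballP[e /= e0 eU].
  (* A box whose centre is within [1 / (n + 1)] of [x] contains [x], and its points are within
     [2 / (n + 1) < e] of [x] in every coordinate. *)
  pose n := Num.bound (2 / e).
  have n0 : 0 < n.+1%:R^-1 :> R by rewrite invr_gt0 ltr0n.
  have ne : 2 * n.+1%:R^-1 < e.
    rewrite ltr_pdivrMr ?ltr0n// mulrC -ltr_pdivrMr//.
    rewrite (lt_le_trans (archi_boundP _))//; first by rewrite divr_ge0// ltW.
    by rewrite ler_nat.
  have qx (i : 'I_d) : exists q : rat, x i 0 - n.+1%:R^-1 < ratr q < x i 0 + n.+1%:R^-1.
    have [|q] := @rat_in_itvoo R (x i 0 - n.+1%:R^-1) (x i 0 + n.+1%:R^-1).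
      by rewrite ltrD2l (lt_trans _ n0)// oppr_lt0.
    by rewrite in_itv /= => ?; exists q.
  have [q qP] := choice qx.
  pose c : 'cV[rat]_d := \col_i q i.
  exists (pickle (c, n)) => //; rewrite /B pickleK /=; split.
    move=> y yb; apply: eU; split => // i j; rewrite (ord1 j) /ball /=.
    have := yb i; have := qP i; rewrite mxE ltr_norml.
    move: ne; move: (n.+1%:R^-1 : R) => r ?.
    by move=> /andP[? ?] /andP[? ?]; apply/andP; split; lra.
  move=> i; have := qP i; rewrite mxE; move: (n.+1%:R^-1 : R) => r /andP[? ?].
  by apply/andP; split; lra.
apply: rcl_sets_bigcup;
  try solve [exact: trigset_meas|exact: trigset_mul|exact: trigset_bnd
            |exact: trigset_lin|exact: trigset_cst].
move=> k; rewrite /B; case: unpickle => [cn|]; last first.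
  by rewrite /rcl_sets /= indic0; apply: rcl_cst; [exact: trigset_meas|exact: trigset_cst].
have [sU|nU] := pselect (ratbox cn.1 cn.2 `<=` U).
  rewrite (_ : [set x | _] = ratbox cn.1 cn.2); first exact: rcl_ratbox.
  by apply/seteqP; split => x /= => [[]|].
rewrite (_ : [set x | _] = set0); last by apply/seteqP; split => x /= => [[]|].
by rewrite /rcl_sets /= indic0; apply: rcl_cst; [exact: trigset_meas|exact: trigset_cst].
Qed.

Lemma rcl_measurable (B : set (Rd R d)) : measurable B -> rcl_setsR B.
Proof.
move: B; apply: smallest_sub; last exact: rcl_open.
apply: rcl_sets_sigma_algebra;
  [exact: trigset_meas|exact: trigset_lin|exact: trigset_mul
  |exact: trigset_bnd|exact: trigset_cst].
Qed.

Lemma trigset_dense f : L2fun mu f -> L2cl (T := Rd R d) mu (trigset setT) f.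
Proof.
move=> [mr [mi jf]]; apply: L2cl_full => //.
- exact: trigset_meas.
- exact: trigset_lin.
- exact: trigset_cst.
- exact: rcl_measurable.
Qed.

(** The closure is a closed linear space: once it contains every exponential it contains every
    trigonometric polynomial, and these are dense. *)
Lemma trigset_dense_sub S f : (forall xi, L2cl (T := Rd R d) mu (trigset S) (expo xi)) ->
  L2fun mu f -> L2cl (T := Rd R d) mu (trigset S) f.
Proof.
move=> Sd fL; have [mf fd] := trigset_dense fL.
apply: L2cl_closed => //; first exact: trigset_meas.
move=> e /fd[_ [l _ ->] fl]; exists (trigpoly l) => //.
apply: (L2cl_sum (T := Rd R d) (@trigset_meas S) (@trigset_lin S) l (fun a => a.1)
   (f := fun a => expo a.2)) => //.
exact: trigset0.
Qed.

End TrigonometricPolynomials.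

(** * Inner products and projections of exponentials *)

Section Projection.
Local Open Scope complex_scope.
Variables (R : realType) (d : nat) (mu : probability (Rd R d) R).
Implicit Types (xi eta x : 'cV[R]_d).

Lemma bounded_continuous_integrable (f : 'cV[R]_d -> R) : bounded_continuous f ->
  mu.-integrable setT (EFin \o (f : Rd R d -> R)).
Proof.
move=> [cf [M fM]]; apply: measurable_bounded_integrable => //.
- by rewrite (le_lt_trans (probability_le1 _ _))// ltry.
- exact: continuous_Rd_measurable.
- by exists M; split => [|N MN x _ /=]; [exact: num_real|rewrite (le_trans (fM x))// ltW].
Qed.

Lemma cos_dotv_bounded xi : bounded_continuous (fun x => cos (2 * pi * dotv xi x)).
Proof. by split; [exact: cos_dotv_continuous|exists 1 => x; exact: cos_max]. Qed.

Lemma sin_dotv_bounded xi : bounded_continuous (fun x => sin (2 * pi * dotv xi x)).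
Proof. by split; [exact: sin_dotv_continuous|exists 1 => x; exact: sin_max]. Qed.

(** Real parts suffice because this is applied to squared moduli; the minus sign in the exponent
    matches [fourier]. *)
Lemma Rintegral_trigpoly (l : seq (R[i] * 'cV[R]_d)) :
  let f := fun x : Rd R d => complex.Re (\sum_(a <- l) a.1 * cexp2pi (- dotv a.2 x)) in
  mu.-integrable setT (EFin \o f) /\
  Rintegral mu setT f = complex.Re (\sum_(a <- l) a.1 * fourier mu a.2).
Proof.
elim: l => [|[w eta] l [il El]] f.
  have -> : f = fun=> 0 by apply/funext => x; rewrite /f big_nil.
  rewrite big_nil /= Rintegral_cst// mul0r; split => //.
  by apply: bounded_continuous_integrable; split; [exact: cst_continuous|exists 0 => x; rewrite normr0].
pose g := fun x : Rd R d => complex.Re (\sum_(a <- l) a.1 * cexp2pi (- dotv a.2 x)).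
have fE : f = fun x => complex.Re w * cos (2 * pi * dotv eta x) +
    complex.Im w * sin (2 * pi * dotv eta x) + g x.
  apply/funext => x; rewrite /f /g big_cons raddfD /=; congr (_ + _).
  by case: (w) => a b /=; rewrite mulrN cosN sinN mulrN opprK.
have ic := bounded_continuous_integrable (cos_dotv_bounded eta).
have js := bounded_continuous_integrable (sin_dotv_bounded eta).
have ic' : mu.-integrable setT
    (EFin \o (fun x : Rd R d => complex.Re w * cos (2 * pi * dotv eta x))).
  exact: (integrableZl measurableT (complex.Re w) ic).
have js' : mu.-integrable setT
    (EFin \o (fun x : Rd R d => complex.Im w * sin (2 * pi * dotv eta x))).
  exact: (integrableZl measurableT (complex.Im w) js).
have ics : mu.-integrable setT
    (EFin \o (fun x : Rd R d => complex.Re w * cos (2 * pi * dotv eta x) +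
     complex.Im w * sin (2 * pi * dotv eta x))) by exact: (integrableD measurableT ic' js').
rewrite fE; split; first exact: (integrableD measurableT ics il).
rewrite RintegralD// RintegralD// RintegralZl// RintegralZl// El big_cons raddfD /=.
by congr (_ + _); case: (w) => a b /=; rewrite mulrN opprK.
Qed.

Lemma fourier0 : fourier mu 0 = 1.
Proof.
apply/eqP; rewrite eq_complex /=.
under eq_Rintegral do rewrite dotv0l mulr0 cos0.
under [in X in _ && X]eq_Rintegral do rewrite dotv0l mulr0 sin0.
by rewrite !Rintegral_cst//= probability_setT /= mul1r mul0r oppr0 !eqxx.
Qed.

Lemma L2inner_expo xi eta : L2inner mu (expo xi) (expo eta) = fourier mu (eta - xi).
Proof.
rewrite /L2inner /fourier; apply/eqP; rewrite eq_complex /=.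
have E x : expo xi x * (expo eta x)^* = cexp2pi (- dotv (eta - xi) x).
  by rewrite /expo cexp2pi_conj -cexp2piD dotvDl dotvNl opprB.
apply/andP; split; apply/eqP.
  apply: eq_Rintegral => x _; rewrite [LHS](congr1 (@complex.Re R) (E x)) /=.
  by rewrite mulrN cosN.
rewrite -[RHS]mulN1r -RintegralZl//; last exact: bounded_continuous_integrable (sin_dotv_bounded _).
apply: eq_Rintegral => x _; rewrite [LHS](congr1 (@complex.Im R) (E x)) /=.
by rewrite mulrN sinN mulN1r.
Qed.

(* The sum is the orthogonal projection of [expo (- xi)] onto the span of [S]. *)
Lemma sqint_projection (S : seq 'cV[R]_d) xi : uniq S ->
  {in S &, forall l1 l2, l1 != l2 -> fourier mu (l2 - l1) = 0} ->
  (sqint (T := Rd R d) mu (fun x => (expo (- xi) x -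
     \sum_(l <- S) fourier mu (xi + l) * expo l x)%R) =
   (1 - \sum_(l <- S) csqn (fourier mu (xi + l)))%R%:E)%E.
Proof.
move=> uS oS; pose c l := fourier mu (xi + l).
pose L : seq (R[i] * 'cV[R]_d) := (1, 0) :: [seq (- (2 * (c l)^*), xi + l) | l <- S] ++
  [seq (c l * (c m)^*, m - l) | l <- S, m <- S].
have pt x : csqn (expo (- xi) x - \sum_(l <- S) c l * expo l x) =
    complex.Re (\sum_(a <- L) a.1 * cexp2pi (- dotv a.2 x)).
  have -> : \sum_(a <- L) a.1 * cexp2pi (- dotv a.2 x) =
     1 - 2 * (expo (- xi) x * (\sum_(l <- S) c l * expo l x)^*) +
     (\sum_(l <- S) c l * expo l x) * (\sum_(l <- S) c l * expo l x)^*.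
    rewrite /L big_cons big_cat /= big_map big_allpairs_dep /= dotv0l oppr0 cexp2pi0 mulr1.
    rewrite addrA; congr (1 + _ + _).
      rewrite rmorph_sum /= !mulr_sumr -sumrN; apply: eq_bigr => l _.
      rewrite rmorphM /= /expo cexp2pi_conj dotvNl dotvDl opprD cexp2piD.
      by ring.
    rewrite rmorph_sum mulr_suml; apply: eq_bigr => l _.
    rewrite mulr_sumr; apply: eq_bigr => m _.
    rewrite rmorphM /= /expo cexp2pi_conj dotvDl dotvNl opprD opprK cexp2piD.
    by ring.
  have : csqn (expo (- xi) x) = 1 by exact: csqn_cexp2pi.
  case: (expo (- xi) x) (\sum_(l <- S) c l * expo l x) => [a b] [p q].
  have -> : Num.conj (p +i* q) = p -i* q :> R[i] by [].
  by rewrite /csqn /= => h; rewrite -{1}h; ring.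
have [iL EL] := Rintegral_trigpoly L.
rewrite /sqint; under eq_integral do rewrite pt.
rewrite -[LHS]fineK; last first.
  by rewrite integrable_fin_num.
congr (_%:E); rewrite -[LHS]/(Rintegral mu setT _) EL /L big_cons big_cat /=.
rewrite big_map big_allpairs_dep /= fourier0 mulr1.
(* Orthogonality leaves only the diagonal of the double sum. *)
have -> : \sum_(l <- S) \sum_(m <- S) c l * (c m)^* * fourier mu (m - l) =
    \sum_(l <- S) (csqn (c l))%:C.
  apply: eq_big_seq => l lS; rewrite (bigD1_seq l)//= subrr fourier0 mulr1 csqnE.
  rewrite big_seq_cond big1 ?addr0// => m /andP[mS ml].
  by rewrite oS ?mulr0// eq_sym.
have -> : \sum_(l <- S) - (2 * (c l)^*) * fourier mu (xi + l) =
    - \sum_(l <- S) (2 * csqn (c l))%:C.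
  rewrite -sumrN; apply: eq_bigr => l _; 
  have -> : (2 * csqn (c l))%:C = 2 * (csqn (c l))%:C :> R[i] by rewrite rmorphM rmorph_nat.
  by rewrite csqnE -/(c l); ring.
rewrite -!rmorph_sum -rmorphN -rmorphD -(rmorph1 (@real_complex R)) -rmorphD /=.
by rewrite -mulr_sumr; ring.
Qed.

End Projection.

(** * Operator norm and Euclidean norm *)

Section OperatorNorm.
Variables (R : realType) (d : nat).
Implicit Types (x y : 'cV[R]_d) (M : 'M[R]_d).

Lemma dotv_ge0 x : 0 <= dotv x x.
Proof. by apply: sumr_ge0 => i _; rewrite -expr2 sqr_ge0. Qed.

Lemma eucl_lt x (e : R) : 0 < e -> (eucl x < e) = (dotv x x < e ^+ 2).
Proof.
move=> e0; rewrite -{1}(gtr0_norm e0) -sqrtr_sqr /eucl.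
by rewrite ltr_sqrt // exprn_gt0.
Qed.

Lemma eucl_half_lt x y (e : R) : eucl x < e / 2 -> eucl y < e / 2 -> 0 < e ->
  eucl (x + y) < e.
Proof.
(* The bound [|x + y|^2 <= 2 |x|^2 + 2 |y|^2] follows from [|x - y|^2 >= 0]. *)
move=> xe ye e0; move: xe ye; rewrite !eucl_lt ?divr_gt0// => xe ye.
have : 0 <= dotv (x - y) (x - y) by exact: dotv_ge0.
rewrite !(dotvDl, dotvDr) !(dotvC _ (- y)) !(dotvC _ x) !dotvNl !(dotvC _ (- y)) !dotvNl.
by rewrite !(dotvC y x); nra.
Qed.

Lemma coord_le_eucl x i : `|x i 0| <= eucl x.
Proof.
rewrite -sqrtr_sqr /eucl ler_sqrt ?dotv_ge0// /dotv (bigD1 i)//= expr2 lerDl.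
by apply: sumr_ge0 => k _; rewrite -expr2 sqr_ge0.
Qed.

Lemma eucl_le_sum x : eucl x <= \sum_i `|x i 0|.
Proof.
have s0 (s : seq 'I_d) : 0 <= \sum_(i <- s) `|x i 0| by exact: sumr_ge0.
rewrite -[leRHS]ger0_norm// -sqrtr_sqr /eucl ler_sqrt ?sqr_ge0// /dotv.
elim: (index_enum _) => [|i s IHs]; first by rewrite !big_nil expr0n.
rewrite !big_cons sqrrD -expr2 real_normK ?num_real// -addrA lerD2l (le_trans IHs)//.
by rewrite lerDr mulrn_wge0// mulr_ge0.
Qed.

Lemma entry_le_opnorm M i j : `|M i j| <= opnorm M.
Proof.
have -> : M i j = (M *m delta_mx j 0 : 'cV[R]_d) i 0.
  by rewrite -colE mxE.
rewrite (le_trans (coord_le_eucl _ _))// /opnorm; apply: sup_upper_bound; last first.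
  exists (delta_mx j 0) => //=; rewrite /eucl /dotv (bigD1 j)//= big1 => [|k kj].
    by rewrite !mxE !eqxx mulr1 addr0 sqrtr1.
  by rewrite !mxE (negbTE kj) mul0r.
(* The supremum bounds its set only if the set is nonempty and bounded above; the sum of all
   [|M k l|] is a bound on the unit ball. *)
split; first by exists (eucl (M *m 0)), 0 => //=; rewrite /eucl dotv0l sqrtr0.
exists (\sum_k \sum_l `|M k l|) => _ [x /= x1 <-].
rewrite (le_trans (eucl_le_sum _))//; apply: ler_sum => k _.
rewrite mxE (le_trans (ler_norm_sum _ _ _))//; apply: ler_sum => l _.
by rewrite normrM ler_piMr// (le_trans (coord_le_eucl _ _)).
Qed.

(** The estimate goes through the entries, which transposition only permutes. *)
Lemma opnorm_cvg0_eucl (M : nat -> 'M[R]_d) x (e : R) : opnorm (M n) @[n --> \oo] --> 0 ->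
  0 < e -> exists N, forall n, (N <= n)%N -> eucl ((M n)^T *m x) < e.
Proof.
move=> M0 e0; pose C := \sum_(i < d) \sum_(j < d) `|x j 0|.
have C0 : 0 <= C by apply: sumr_ge0 => i _; exact: sumr_ge0.
have eC : 0 < e / (C + 1) by rewrite divr_gt0// ltr_wpDl.
have [N _ Ne] := cvgr_lt _ M0 _ eC; exists N => n /Ne /= Mn.
apply: (@le_lt_trans _ _ (opnorm (M n) * C)).
  rewrite (le_trans (eucl_le_sum _))// /C mulr_sumr; apply: ler_sum => i _.
  rewrite mxE (le_trans (ler_norm_sum _ _ _))// mulr_sumr; apply: ler_sum => j _.
  by rewrite normrM mxE ler_wpM2r// entry_le_opnorm.
apply: (@le_lt_trans _ _ (e / (C + 1) * C)); first by rewrite ler_wpM2r// ltW.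
by rewrite -mulrA gtr_pMr// mulrC ltr_pdivrMr ?ltr_wpDl// mul1r ltrDl.
Qed.

Lemma opnorm_cvg0_eucl_seq (M : nat -> 'M[R]_d) (s : seq 'cV[R]_d) (e : R) :
  opnorm (M n) @[n --> \oo] --> 0 -> 0 < e ->
  exists N, forall n x, (N <= n)%N -> x \in s -> eucl ((M n)^T *m x) < e.
Proof.
move=> M0 e0; elim: s => [|x s [N Ns]]; first by exists 0%N.
have [K Kx] := opnorm_cvg0_eucl x M0 e0.
exists (maxn N K) => n y; rewrite geq_max => /andP[Nn Kn].
by rewrite inE => /orP[/eqP ->|]; [exact: Kx|exact: Ns].
Qed.

End OperatorNorm.

(** * The increasing tower of spectra *)

Section Construction.
Local Open Scope complex_scope.
Variables (R : realType) (d : nat).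
Variables (Rs : nat -> 'M[int]_d) (Bs : nat -> seq 'cV[int]_d).
Variables (mu : probability (Rd R d) R).
Variables (nj : nat -> nat) (nu : nat -> probability (Rd R d) R).
Hypothesis adm : forall n, (0 < n)%N -> admissible R (Rs n) (Bs n).
Hypothesis wmu : tail_conv_weakly_to Rs Bs 0 mu.
Hypothesis vanish : opnorm (invmx (tailprod R Rs 0 n)) @[n --> \oo] --> (0 : R).
Hypothesis njS : forall j, (nj j < nj j.+1)%N.
Hypothesis wnu : forall j, tail_conv_weakly_to Rs Bs (nj j) (nu j).
Variables (eps gam : R).
Hypothesis eps0 : 0 < eps.
Hypothesis gam0 : 0 < gam.
Hypothesis equipos : forall x : 'cV[R]_d, (forall i, 0 <= x i 0 < 1) ->
  forall j, exists k : 'cV[int]_d, (x = 0 -> k = 0) /\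
    forall y : 'cV[R]_d, eucl y < gam -> eps <= cmod (fourier (nu j) (x + y + ivec R k)).

Local Notation F := (fconv (R := R) Rs Bs 0).
Local Notation D n := ((invmx (tailprod R Rs 0 n))^T).

Let Rs_unit n : (0 < n)%N -> imx R (Rs n) \in unitmx.
Proof. by move=> /adm[exA _]; exact: expanding_unitmx. Qed.

Let Bs_neq0 n : (0 < n)%N -> Bs n != [::].
Proof. exact: (weak_limit_factor_neq_nil wmu). Qed.

Lemma nj_ge j : (j <= nj j)%N.
Proof. by elim: j => // j IHj; rewrite (leq_ltn_trans IHj). Qed.

Lemma nj_lt i j : (i < j)%N -> (nj i < nj j)%N.
Proof.
elim: j => // j IHj; rewrite ltnS leq_eqVlt => /orP[/eqP ->//|/IHj ij].
exact: ltn_trans (njS j).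
Qed.

(** Integer parts bring [z] into the unit cube; they are absorbed into the integer shift. *)
Lemma equipos_shift j (z : 'cV[R]_d) : exists k : 'cV[int]_d,
  forall y : 'cV[R]_d, eucl y < gam -> eps <= cmod (fourier (nu j) (z + ivec R k + y)).
Proof.
pose f : 'cV[int]_d := \col_i Num.floor (z i 0).
have [i|k [_ kP]] := equipos (x := z - ivec R f) _ j.
  rewrite !mxE subr_ge0 floor_le /= ltrBlDl.
  by have := floorD1_gt (z i 0); rewrite intrD.
exists (k - f) => y /kP; congr (eps <= cmod (fourier _ _)).
by rewrite ivecB; apply/matrixP => i l; rewrite !mxE; ring.
Qed.

(** The radius [gam / 2] leaves the other half of [gam] for the elements kept from the previous
    stage. *)
Definition good j (S : seq 'cV[int]_d) := forall l, l \in S ->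
  forall y : 'cV[R]_d, eucl y < gam / 2 ->
    eps <= cmod (fourier (nu j) (D (nj j) *m ivec R l + y)).

(** The set [S] is composed with a spectrum of the factors between the two stages, and each
    resulting [v] is moved by [Q^T k]. This is a period of the later [F], and moves the argument of
    the transform of [nu j'] by exactly [k], so equi-positivity can choose [k]. *)
Lemma extend_spectrum j S : spec (F (nj j)) S -> exists j' S',
  [/\ (j < j')%N, {subset S <= S'}, spec (F (nj j')) S' & good j' S'].
Proof.
move=> SF; have gam20 : 0 < gam / 2 by rewrite divr_gt0.
have [N NP] := opnorm_cvg0_eucl_seq [seq ivec R l | l <- S] vanish gam20.
pose j' := maxn N j.+1; have jj' : (j < j')%N by rewrite leq_maxr.
have near0 l : l \in S -> eucl (D (nj j') *m ivec R l) < gam / 2.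
  move=> lS; apply: NP; last exact: map_f.
  by rewrite (leq_trans _ (nj_ge _))// leq_maxl.
have le_n : (nj j <= nj j')%N by rewrite ltnW// nj_lt.
have [L [LF L0]] := fconv_spec Rs_unit Bs_neq0 adm (nj j) (nj j' - nj j).
pose P := tailprodZ Rs 0 (nj j); pose Q := tailprodZ Rs 0 (nj j').
have DQ k : D (nj j') *m ivec R (Q^T *m k) = ivec R k.
  rewrite ivec_mul imx_tr -tailprodE mulmxA -trmx_mul mulmxV ?trmx1 ?mul1mx//.
  exact: tailprod_unit.
have kex (v : 'cV[int]_d) : exists k : 'cV[int]_d, (v \in S -> k = 0) /\
    forall y, eucl y < gam / 2 ->
    eps <= cmod (fourier (nu j') (D (nj j') *m ivec R (v + Q^T *m k) + y)).
  have [vS|vS] := boolP (v \in S).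
    exists 0; split => // y yg; rewrite mulmx0 addr0.
    have x01 (i : 'I_d) : 0 <= (0 : 'cV[R]_d) i 0 < 1 by rewrite mxE lexx ltr01.
    have [k [k0 kP]] := equipos x01 j'.
    (* An element of [S] stays in place: its image has norm below [gam / 2], so equi-positivity at
       [x = 0], where the shift is 0, already covers it. *)
    have := kP (D (nj j') *m ivec R v + y) (eucl_half_lt (near0 v vS) yg gam0).
    by rewrite k0// ivec0 addr0 add0r.
  have [k kP] := equipos_shift j' (D (nj j') *m ivec R v).
  exists k; split => // y yg; rewrite ivecD mulmxDr DQ; apply: kP.
  by rewrite (lt_trans yg)// ltr_pdivrMr// ltr_pMr// ltr1n.
have [k kP] := choice kex.
have comb : spec (F (nj j')) [seq l + P^T *m t | l <- S, t <- L].
  apply: (spec_comp _ _ _ SF LF).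
  - by rewrite -tailprodE tailprod_unit.
  - exact: fconv_periodic.
  - move=> xi; rewrite -tailprodE.
    by have := fconv_cat Bs Rs_unit 0 (nj j) (nj j' - nj j) xi; rewrite add0n subnKC.
exists j', [seq v + Q^T *m k v | v <- [seq l + P^T *m t | l <- S, t <- L]].
split => //.
(* Here [l] arises as [l + P^T 0] with 0 in [L], and is not moved. *)
- move=> l lS; apply/mapP; exists l; last by rewrite (kP l).1// mulmx0 addr0.
  by apply/allpairsP; exists (l, 0); split => //=; rewrite mulmx0 addr0.
- by apply: spec_mod => //; exact: fconv_periodic.
- by move=> _ /mapP[v _ ->] y; exact: (kP v).2.
Qed.

Lemma spectra_tower : exists (jm : nat -> nat) (Lm : nat -> seq 'cV[int]_d),
  [/\ forall n, (jm n < jm n.+1)%N, forall n, {subset Lm n <= Lm n.+1},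
      forall n, spec (F (nj (jm n))) (Lm n) & forall n, good (jm n) (Lm n)].
Proof.
pose T := (nat * seq 'cV[int]_d)%type.
(* The implication makes the step total, as choice requires. *)
have step (s : T) : exists s' : T, spec (F (nj s.1)) s.2 ->
    [/\ (s.1 < s'.1)%N, {subset s.2 <= s'.2}, spec (F (nj s'.1)) s'.2 & good s'.1 s'.2].
  have [/extend_spectrum[j' [S' ?]]|ns] := pselect (spec (F (nj s.1)) s.2).
    by exists (j', S').
  by exists s => /ns.
have [f fP] := choice step.
have [S0 [S0F _]] := fconv_spec Rs_unit Bs_neq0 adm 0 (nj 0).
(* The initial set is a spectrum but need not be [good]; one application of [f] makes the first
   stage good. *)
pose st n := iter n.+1 f (0%N, S0).
have stP n : spec (F (nj (st n).1)) (st n).2 /\ good (st n).1 (st n).2.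
  elim: n => [|n [IHn _]]; first by have [] := fP (0%N, S0) S0F.
  by have [] := fP (st n) IHn.
exists (fun n => (st n).1), (fun n => (st n).2); split => n; try by case: (stP n).
- by have [] := fP (st n) (stP n).1.
- by have [] := fP (st n) (stP n).1.
Qed.

(** * The union of the tower is a spectrum of [mu] *)

Variables (jm : nat -> nat) (Lm : nat -> seq 'cV[int]_d).
Hypothesis jmS : forall n, (jm n < jm n.+1)%N.
Hypothesis LmS : forall n, {subset Lm n <= Lm n.+1}.
Hypothesis Lm_spec : forall n, spec (F (nj (jm n))) (Lm n).
Hypothesis Lm_good : forall n, good (jm n) (Lm n).

Lemma Lm_subset m n : (m <= n)%N -> {subset Lm m <= Lm n}.
Proof.
elim: n => [|n IHn]; first by rewrite leqn0 => /eqP ->.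
rewrite leq_eqVlt => /orP[/eqP ->//|/IHn mn] l /mn; exact: LmS.
Qed.

Lemma jm_ge n : (n <= nj (jm n))%N.
Proof.
apply: leq_trans (nj_ge _).
by elim: n => // n IHn; rewrite (leq_ltn_trans IHn).
Qed.

Lemma Lm_uniq n : uniq (Lm n).
Proof. by apply: spec_uniq (Lm_spec n) _; exact: fconv0. Qed.

Lemma fourier_Lm n xi : fourier mu xi =
  F (nj (jm n)) xi * fourier (nu (jm n)) (D (nj (jm n)) *m xi).
Proof. exact: fourier_factor. Qed.

Lemma Lm_orthogonal n l1 l2 : l1 \in Lm n -> l2 \in Lm n -> l1 != l2 ->
  fourier mu (ivec R l2 - ivec R l1) = 0.
Proof.
move=> l1n l2n l12; rewrite (fourier_Lm n).
by rewrite (spec_orthogonal (Lm_spec n) _ l1n l2n l12) ?mul0r// fconv0.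
Qed.

Lemma Lm_sum_le1 n xi : \sum_(l <- Lm n) csqn (fourier mu (xi + ivec R l)) <= 1.
Proof.
rewrite -[leRHS](Lm_spec n xi); apply: ler_sum => l _.
by rewrite (fourier_Lm n) csqnM ler_piMr ?csqn_ge0// (csqn_fourier_le1 _ (@wnu _)).
Qed.

Lemma Lm_sum_split m n (f : 'cV[int]_d -> R) : (m <= n)%N ->
  \sum_(l <- Lm n) f l = \sum_(l <- Lm m) f l + \sum_(l <- Lm n | l \notin Lm m) f l.
Proof.
move=> mn; rewrite (bigID (mem (Lm m))) /=; congr (_ + _).
rewrite -big_filter; apply: perm_big; apply: uniq_perm.
- by rewrite filter_uniq// Lm_uniq.
- exact: Lm_uniq.
- move=> l; rewrite mem_filter; case: (boolP (l \in Lm m)) => //= lm.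
  exact: (Lm_subset mn lm).
Qed.

(* Equi-positivity gives |F_n|^2 <= eps^-2 |mu^|^2 on Lm n: this dominates the tails of the sums
   [\sum_(l <- Lm n) |F_n (xi + l)|^2 = 1] uniformly in n. *)
Lemma Lm_sum_sup xi (e : R) : 0 < e ->
  exists n, 1 - e <= \sum_(l <- Lm n) csqn (fourier mu (xi + ivec R l)).
Proof.
move=> e0; pose a n := \sum_(l <- Lm n) csqn (fourier mu (xi + ivec R l)).
have a_nd m n : (m <= n)%N -> a m <= a n.
  by move=> mn; rewrite /a (Lm_sum_split _ mn) lerDl sumr_ge0// => *; exact: csqn_ge0.
have a_cvg : cvgn a.
  apply: nondecreasing_is_cvgn => //; exists 1 => _ [n _ <-]; exact: Lm_sum_le1.
have de : 0 < e * eps ^+ 2 by rewrite mulr_gt0// exprn_gt0.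
(* Beyond [m] the sums [a] grow by less than [e * eps ^+ 2] in total. *)
have [m am] : exists m, limn a - e * eps ^+ 2 < a m.
  have : limn a - e * eps ^+ 2 < limn a by rewrite ltrBlDr ltrDl.
  by move=> /(cvgr_gt _ a_cvg) [m _ /(_ m (leqnn m))]; exists m.
exists m; rewrite leNgt; apply/negP => am1.
have [N NP] := opnorm_cvg0_eucl xi vanish (divr_gt0 gam0 (ltr0n R 2 : (0 < 2%:R))).
(* If [a m < 1 - e], then [s K < 1 - e] for large [K], and at such a stage the terms outside [Lm m]
   exceed [e]. They are however at most [eps^-2 (a n - a m)], hence at most [e]. *)
pose s K := \sum_(l <- Lm m) csqn (F K (xi + ivec R l)).
have s_cvg : s K @[K --> \oo] --> a m.
  apply: cvg_big => [|l _]; first exact: add_continuous.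
  exact: csqn_fconv_cvg.
have [K _ KP] := cvgr_lt _ s_cvg _ am1.
pose n := maxn m (maxn N K).
have mn : (m <= n)%N by rewrite leq_maxl.
have Nn : (N <= n)%N by rewrite leq_max leq_maxl orbT.
have Kn : (K <= n)%N by rewrite leq_max leq_maxr orbT.
have := KP (nj (jm n)) (leq_trans Kn (jm_ge n)) => /= snm.
suff : 1 - s (nj (jm n)) <= e by rewrite lerBlDr -lerBlDl leNgt snm.
rewrite -(Lm_spec n xi) (Lm_sum_split _ mn) addrC addKr.
rewrite -(ler_pM2r (exprn_gt0 2 eps0)) mulr_suml.
apply: (@le_trans _ _ (\sum_(l <- Lm n | l \notin Lm m) csqn (fourier mu (xi + ivec R l)))).
  rewrite big_seq_cond [leRHS]big_seq_cond; apply: ler_sum => l /andP[ln _].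
  rewrite (fourier_Lm n) csqnM ler_wpM2l ?csqn_ge0// -(cmod_ge _ (ltW eps0)) mulmxDr.
  (* [good] is used with [y] the image of [xi], which is shorter than [gam / 2] by the choice of
     [N]. *)
  rewrite (addrC (_ *m xi)); apply: (@Lm_good n l ln).
  by apply: NP; rewrite (leq_trans Nn)// jm_ge.
have -> : \sum_(l <- Lm n | l \notin Lm m) csqn (fourier mu (xi + ivec R l)) = a n - a m.
  by rewrite /a (Lm_sum_split _ mn) addrC addKr.
have an : a n <= limn a by exact: nondecreasing_cvgn_le.
by rewrite lerBlDr -lerBlDl (le_trans _ (ltW am))// lerB.
Qed.

Definition tower_set : set 'cV[R]_d := [set x | exists n, exists2 l, l \in Lm n & x = ivec R l].

Lemma tower_countable : countable tower_set.
Proof.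
have : tower_set `<=` range (@ivec R d) by move=> _ [n [l _ ->]]; exists l.
move=> /subset_card_le/sub_countable; apply.
by apply: (sub_countable (card_image_le _ _)); exact: countableP.
Qed.

Lemma expo_closure xi : L2cl (T := Rd R d) mu (trigset tower_set) (expo xi).
Proof.
split; first exact: mfunC_expo.
(* The projection formula concerns [expo (- xi)], hence the sign; the squared error is at most
   [e / 2], strictly below [e]. *)
move=> e e0; have [n np] := Lm_sum_sup (- xi) (divr_gt0 e0 (ltr0n R 2 : (0 < 2%:R))).
pose S := [seq ivec R l | l <- Lm n].
exists (fun x => \sum_(l <- S) fourier mu (- xi + l) * expo l x).
  exists [seq (fourier mu (- xi + l), l) | l <- S].
    by move=> _ /mapP[_ /mapP[l ln ->] ->]; exists n, l.
  by apply/funext => x; rewrite /trigpoly !big_map.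
have := @sqint_projection R d mu S (- xi); rewrite opprK => ->.
- by rewrite lte_fin big_map; move: np; set sum := \sum_(_ <- _) _ => np; lra.
- by rewrite map_inj_uniq ?Lm_uniq//; exact: ivec_inj.
- move=> _ _ /mapP[l1 l1n ->] /mapP[l2 l2n ->] l12; apply: (@Lm_orthogonal n) => //.
  by apply: contra_neq l12 => ->.
Qed.

Lemma tower_spectrum : spectrum mu tower_set.
Proof.
split; first exact: tower_countable.
split.
  move=> _ _ [n1 [l1 l1n ->]] [n2 [l2 l2n ->]]; rewrite L2inner_expo.
  have [<-|l12] := eqVneq (ivec R l1) (ivec R l2); first by rewrite subrr fourier0.
  apply: (@Lm_orthogonal (maxn n1 n2)).
  - by apply: Lm_subset l1n; rewrite leq_maxl.
  - by apply: Lm_subset l2n; rewrite leq_maxr.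
  - by apply: contra_neq l12 => ->.
move=> f fL e e0.
have [_ /(_ e e0)[_ [l lS ->] fl]] := trigset_dense_sub expo_closure fL.
have [c lE] := trigpoly_collect l.
exists (undup (unzip2 l)), c; split.
  by move=> xi; rewrite mem_undup => /mapP[a al ->]; apply/mem_set; exact: lS.
by move: fl; rewrite lE.
Qed.

End Construction.

Unset Implicit Arguments.
Set Strict Implicit.

Theorem theorem1p1 (R : realType) (d : nat)
  (Rs : nat -> 'M[int]_d) (Bs : nat -> seq 'cV[int]_d)
  (mu : probability (Rd R d) R)
  (nj : nat -> nat) (nu : nat -> probability (Rd R d) R) :
  (forall n, (0 < n)%N -> admissible R (Rs n) (Bs n)) ->
  tail_conv_weakly_to Rs Bs 0 mu ->
  (fun n => opnorm (invmx (tailprod R Rs 0 n))) @ \oo --> (0 : R) ->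
  (forall j, (0 < nj j)%N) -> (forall j, (nj j < nj j.+1)%N) ->
  (forall j, tail_conv_weakly_to Rs Bs (nj j) (nu j)) ->
  equi_positive nu ->
  exists Lam : set 'cV[R]_d, Lam `<=` range (@ivec R d) /\ spectrum mu Lam.
Proof.
move=> adm wmu vanish _ njS wnu [eps [gam [eps0 [gam0 equipos]]]].
have [jm [Lm [jmS LmS Lm_spec Lm_good]]] := spectra_tower adm wmu vanish njS gam0 equipos.
exists (@tower_set R d Lm); split; first by move=> _ [n [l _ ->]]; exists l.
exact: (tower_spectrum adm wmu vanish njS wnu eps0 gam0 jmS LmS Lm_spec Lm_good).
Qed.
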